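(* For every $\varepsilon>0$ there exists a constant $C=C(\varepsilon)$ such that the following holds. Let $p=p(n)$ satisfy $np\ge C$ for all $n$ and $p\to 0$ as $n\to\infty$. Then asymptotically almost surely $$(1-\varepsilon)\sqrt{\frac{n^2p}{\ln (np)}}\;\le\; \mathrm{ccl}(G_{n,p})\;\le\;(1+\varepsilon)\sqrt{\frac{n^2p}{\ln (np)}}.$$
   Context: $G_{n,p}$ denotes the binomial random graph on $n$ vertices in which each pair of vertices is an edge independently with probability $p$. A graph $H$ is a minor of $G$ if for every vertex $h$ of $H$ there is a set $B_h\subseteq V(G)$ inducing a connected subgraph of $G$, the sets $B_h$ are pairwise disjoint, and $G$ has an edge between $B_h$ and $B_{h'}$ whenever $hh'$ is an edge of $H$. $\mathrm{ccl}(G)$ denotes the largest $k$ such that the complete graph $K_k$ is a minor of $G$. An event holds asymptotically almost surely (a.a.s.) if its probability tends to $1$ as $n\to\infty$. $\ln$ is the natural logarithm. *)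

(* Defs.v *)
From HB Require Import structures.
From mathcomp Require Import all_boot all_order all_algebra.
From mathcomp Require Import all_classical all_reals all_analysis.
Set Implicit Arguments. Unset Strict Implicit. Unset Printing Implicit Defensive.
Import Order.TTheory GRing.Theory Num.Theory.
Local Open Scope ring_scope.

(* A (labelled) graph on vertex set 'I_n is encoded by a boolean function on
   ordered pairs; only pairs (i,j) with i < j are meaningful (the G(n,p)
   measure below gives weight 0 to any encoding with a true entry at i >= j). *)
Definition graph (n : nat) := {ffun 'I_n * 'I_n -> bool}.

Definition adj (n : nat) (G : graph n) : rel 'I_n :=
  fun x y => G (x, y) || G (y, x).

Definition gnp_weight (R : realType) (n : nat) (p : R) (G : graph n) : R :=
  \prod_(e : 'I_n * 'I_n)
     (if (e.1 < e.2)%N then (if G e then p else 1 - p)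
      else (if G e then 0 else 1)).

Definition gnp_prob (R : realType) (n : nat) (p : R) (P : pred (graph n)) : R :=
  \sum_(G : graph n | P G) gnp_weight p G.

Definition induced_connected (n : nat) (G : graph n) (B : {set 'I_n}) : bool :=
  [forall x in B, forall y in B,
     connect [rel u v | adj G u v && (u \in B) && (v \in B)] x y].

Definition has_K_minor (n : nat) (G : graph n) (k : nat) : Prop :=
  exists B : 'I_k -> {set 'I_n},
    [/\ forall h, B h != finset.set0,
        forall h, induced_connected G (B h),
        forall h h', h != h' -> [disjoint B h & B h'] &
        forall h h', h != h' ->
          exists x, exists y, [/\ x \in B h, y \in B h' & adj G x y]].

(* ccl G = largest k such that K_k is a minor of G (any such k is <= n,
   since branch sets are disjoint and nonempty). *)
Definition ccl (n : nat) (G : graph n) : nat :=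
  \max_(k < n.+1 | `[< has_K_minor G k >]) k.

(* Main.v *)
(** The upper bound is a first moment computation.  A [K_k] minor is encoded by
a set [U] of vertices and a parent map [f]: the trees of [f] inside [U] span the
branch sets.  Summing over [f] gives a factor at most [(1 + np)^n], so that only
[exp(n O(ln(np)))] choices matter even for bounded [np], while convexity shows that
all pairs of [k] disjoint sets are joined with probability at most
[exp(- k^2/2 (1-p)^(n^2/k^2))], which is much smaller.

The lower bound uses sprinkling.  A sparse first round contains a path on almost
all vertices; it is cut into [k] segments of length [b], about
[(1 + eps/8) sqrt(ln(np)/p)], and a reservoir.  A second round joins all but a small
constant proportion of the pairs of segments.  In round [t = 0, 1, ..., T] the
missing pairs are repaired by segments of length [8^t] of the reservoir: such a
connector sees a random set of branch sets, and is used when this set contains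
exactly one missing pair.  Each round divides the number of missing pairs by 16 and
their maximal degree by 4, so that the short connectors suffice for most pairs and
longer, hence more powerful, connectors are only needed for few pairs.  With
[2^T] of order [n^(1/8)] the last round repairs every remaining pair. *)

Require Import Defs.
From HB Require Import structures.
From mathcomp Require Import all_boot all_order all_algebra.
From mathcomp Require Import boolp reals sequences exp ring lra zify.
Set Implicit Arguments. Unset Strict Implicit. Unset Printing Implicit Defensive.
Import Order.TTheory GRing.Theory Num.Theory.
Local Open Scope ring_scope.

(** * Product measure of the edges *)

Section Expectation.
Variables (R : realType) (n : nat).
Implicit Types (p : R) (G H : graph n) (f g : graph n -> R).
Implicit Types (S T : {set 'I_n * 'I_n}) (X Y : {set 'I_n}).

(** The hard case is bounded np: once the segments have been joined, the number of missing pairs is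
    only known to be a small multiple of n. A single vertex sees a given branch set with probability
    of order n^(-1/2), hence a given missing pair with probability of order 1/n, so linearly many
    such connectors repair each pair only with constant probability. Longer connectors see more, but
    help only once the missing pairs are so sparse that a connector seeing one of them rarely sees
    another. This requires control of their maximal degree too, since two pairs sharing a branch set
    are seen together more often. The factors 4, 8, 16 balance the budgets: from round to round the
    probability of seeing a branch set is multiplied by 4, the length of a connector by 8, the
    number of connectors by 1/16. Number times squared probability, which governs the repair of a
    pair, stays constant, while the vertices used and the edge probability spent both halve, so that
    their sums stay bounded. *)

Definition wt p (e : 'I_n * 'I_n) (b : bool) : R :=
  if (e.1 < e.2)%N then (if b then p else 1 - p) else (if b then 0 else 1).

Definition Ex p f : R := \sum_(G : graph n) gnp_weight p G * f G.

Lemma wt_sum p e : wt p e true + wt p e false = 1.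
Proof. by rewrite /wt; case: ifP => _; ring. Qed.

Lemma wt_ge0 p e b : 0 <= p <= 1 -> 0 <= wt p e b.
Proof. by rewrite /wt => h; case: ifP => _; case: b => //; lra. Qed.

Lemma sum_graph_prod (F : 'I_n * 'I_n -> bool -> R) :
  \sum_(G : graph n) \prod_e F e (G e) = \prod_e (F e true + F e false).
Proof.
by rewrite -(bigA_distr_bigA F); apply: eq_bigr => e _; rewrite big_bool.
Qed.

Lemma gnp_weight_ge0 p G : 0 <= p <= 1 -> 0 <= gnp_weight p G.
Proof. by move=> h; apply: prodr_ge0 => e _; exact: wt_ge0. Qed.

Lemma Ex_cst p c : Ex p (fun _ => c) = c.
Proof.
rewrite /Ex -mulr_suml (sum_graph_prod (wt p)).
by rewrite big1 ?mul1r // => e _; rewrite wt_sum.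
Qed.

Lemma eq_Ex p f g : f =1 g -> Ex p f = Ex p g.
Proof. by move=> fg; apply: eq_bigr => G _; rewrite fg. Qed.

Lemma ExD p f g : Ex p (fun G => f G + g G) = Ex p f + Ex p g.
Proof. by rewrite /Ex -big_split; apply: eq_bigr => G _; rewrite mulrDr. Qed.

Lemma ExZ p c f : Ex p (fun G => c * f G) = c * Ex p f.
Proof. by rewrite /Ex big_distrr; apply: eq_bigr => G _; rewrite mulrCA. Qed.

Lemma ExB p f g : Ex p (fun G => f G - g G) = Ex p f - Ex p g.
Proof.
rewrite (@eq_Ex _ _ (fun G => f G + (-1) * g G)); last by move=> G; ring.
by rewrite ExD ExZ mulN1r.
Qed.

Lemma Ex_sum p (J : Type) (r : seq J) (P : pred J) (F : J -> graph n -> R) :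
  Ex p (fun G => \sum_(j <- r | P j) F j G) = \sum_(j <- r | P j) Ex p (F j).
Proof.
by rewrite /Ex exchange_big; apply: eq_bigr => G _; rewrite big_distrr.
Qed.

Lemma ler_Ex p f g : 0 <= p <= 1 -> (forall G, f G <= g G) -> Ex p f <= Ex p g.
Proof.
by move=> hp fg; apply: ler_sum => G _; rewrite ler_wpM2l ?gnp_weight_ge0.
Qed.

Lemma Ex_ge0 p f : 0 <= p <= 1 -> (forall G, 0 <= f G) -> 0 <= Ex p f.
Proof. by move=> hp f0; rewrite -(Ex_cst p 0); exact: ler_Ex. Qed.

Lemma gnp_probE p (P : pred (graph n)) : gnp_prob p P = Ex p (fun G => (P G)%:R).
Proof.
rewrite /gnp_prob /Ex big_mkcond; apply: eq_bigr => G _.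
by case: (P G); rewrite ?mulr1 ?mulr0.
Qed.

Lemma gnp_prob_le p (P Q : pred (graph n)) :
  0 <= p <= 1 -> (forall G, P G -> Q G) -> gnp_prob p P <= gnp_prob p Q.
Proof.
move=> hp PQ; rewrite !gnp_probE; apply: ler_Ex => // G.
by rewrite ler_nat; case: (P G) (PQ G) => // ->.
Qed.

Lemma gnp_probC p (P : pred (graph n)) :
  gnp_prob p (fun G => ~~ P G) = 1 - gnp_prob p P.
Proof.
rewrite !gnp_probE -[X in X - _](Ex_cst p) -ExB; apply: eq_Ex => G.
by case: (P G) => /=; rewrite ?subrr ?subr0.
Qed.

Lemma gnp_probU p (P Q : pred (graph n)) :
  0 <= p <= 1 ->
  gnp_prob p (fun G => P G || Q G) <= gnp_prob p P + gnp_prob p Q.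
Proof.
move=> hp; rewrite !gnp_probE -ExD; apply: ler_Ex => // G.
by rewrite -natrD ler_nat; case: (P G); case: (Q G).
Qed.

Lemma gnp_prob_exists p (J : finType) (A : pred J) (P : J -> pred (graph n)) :
  0 <= p <= 1 ->
  gnp_prob p (fun G => [exists j, A j && P j G]) <= \sum_(j | A j) gnp_prob p (P j).
Proof.
move=> hp; under eq_bigr do rewrite gnp_probE.
rewrite gnp_probE -Ex_sum; apply: ler_Ex => // G.
case: existsP => [[j /andP[Aj Pj]]|_]; last by apply: sumr_ge0.
by rewrite (bigD1 j) //= Pj lerDl sumr_ge0.
Qed.

Definition depends_on (V : Type) (f : graph n -> V) S :=
  forall G H, (forall e, e \in S -> G e = H e) -> f G = f H.

Definition mix S G H : graph n := [ffun e => if e \in S then G e else H e].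

Lemma gnp_weight_mix p S G H :
  gnp_weight p (mix S G H) * gnp_weight p (mix S H G) =
  gnp_weight p G * gnp_weight p H.
Proof.
rewrite -!big_split; apply: eq_bigr => e _ /=; rewrite !ffunE.
by case: (e \in S) => //; rewrite mulrC.
Qed.

(* Swapping the coordinates outside S between two independent copies of the
   graph preserves their joint law. *)
Lemma Ex_indep p f g S T :
  depends_on f S -> depends_on g T -> [disjoint S & T] ->
  Ex p (fun G => f G * g G) = Ex p f * Ex p g.
Proof.
move=> fS gT dST.
rewrite /Ex big_distrlr /= pair_big /=.
pose sw (x : graph n * graph n) := (mix S x.1 x.2, mix S x.2 x.1).
have swK : involutive sw.
  by move=> [G H]; congr pair; apply/ffunP => e; rewrite !ffunE; case: (e \in S).
rewrite (reindex_inj (inv_inj swK)) /=.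
transitivity (\sum_(x : graph n * graph n)
   (gnp_weight p x.1 * (f x.1 * g x.1)) * gnp_weight p x.2).
  rewrite -(pair_big xpredT xpredT
    (fun G H => gnp_weight p G * (f G * g G) * gnp_weight p H)) /=.
  apply: eq_bigr => G _; rewrite -big_distrr /=.
  by rewrite (sum_graph_prod (wt p)) big1 ?mulr1 // => e _; rewrite wt_sum.
apply: eq_bigr => -[G H] _ /=.
have -> : f (mix S G H) = f G by apply: fS => e eS; rewrite ffunE eS.
have -> : g (mix S H G) = g G.
  apply: gT => e eT; rewrite ffunE; case: ifP => // eS.
  by rewrite (disjointFr dST eS) in eT.
rewrite mulrACA gnp_weight_mix /=; ring.
Qed.

Lemma Ex_indep_prod p (J : eqType) (r : seq J) (F : J -> graph n -> R)
    (S : J -> {set 'I_n * 'I_n}) :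
  uniq r -> (forall j, j \in r -> depends_on (F j) (S j)) ->
  (forall i j, i \in r -> j \in r -> i != j -> [disjoint S i & S j]) ->
  Ex p (fun G => \prod_(j <- r) F j G) = \prod_(j <- r) Ex p (F j).
Proof.
elim: r => [|j r IH] /= => [_ _ _|/andP[jr ur] dF dS].
  by rewrite big_nil (@eq_Ex _ _ (fun=> 1)) ?Ex_cst // => G; rewrite big_nil.
rewrite big_cons -IH //; last 2 first.
- by move=> i ir; apply: dF; rewrite inE ir orbT.
- by move=> i k ir kr; apply: dS; rewrite inE ?ir ?kr orbT.
under eq_Ex do rewrite big_cons.
apply: (@Ex_indep _ _ _ (S j) [set e | has (fun i => e \in S i) r]).
- by apply: dF; rewrite inE eqxx.
- move=> G H GH; apply: eq_big_seq => i ir; apply: (dF i).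
    by rewrite inE ir orbT.
  by move=> e eS; apply: GH; rewrite inE; apply/hasP; exists i.
- rewrite -setI_eq0; apply/eqP/setP => e; rewrite !inE; apply/negbTE/negP.
  case/andP=> eS /hasP[i ir ei].
  have ij : j != i by apply: contraNneq jr => ->.
  have := dS j i; rewrite !inE eqxx ir orbT => /(_ isT isT ij) d.
  by rewrite (disjointFr d eS) in ei.
Qed.

Definition hit G X Y := [exists x in X, exists y in Y, adj G x y].
Definition blk X Y := finset.setX X Y :|: finset.setX Y X.

Lemma hitP G X Y :
  reflect (exists x y, [/\ x \in X, y \in Y & adj G x y]) (hit G X Y).
Proof.
apply: (iffP exists_inP) => [[x xX /exists_inP[y yY a]]|[x [y [xX yY a]]]].
  by exists x, y.
by exists x => //; apply/exists_inP; exists y.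
Qed.

Lemma adj_sym G : symmetric (adj G).
Proof. by move=> x y; rewrite /adj orbC. Qed.

Lemma hitC G X Y : hit G X Y = hit G Y X.
Proof.
by apply/hitP/hitP => -[x [y [? ? ?]]]; exists y, x; rewrite adj_sym.
Qed.

Lemma hitNE G X Y : ~~ hit G X Y = [forall e in blk X Y, ~~ G e].
Proof.
apply/idP/forall_inP => [nh [x y]|h].
  rewrite !inE /= => xy; apply: contra nh => Gxy; apply/hitP.
  by case/orP: xy => /andP[? ?]; [exists x, y|exists y, x]; rewrite /adj Gxy ?orbT.
apply/negP => /hitP[x [y [xX yY]]] /orP[] Gxy.
  by have := h (x, y); rewrite !inE /= xX yY Gxy => /(_ isT).
by have := h (y, x); rewrite !inE /= xX yY Gxy orbT => /(_ isT).
Qed.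

Lemma hit_depends X Y : depends_on (fun G => hit G X Y) (blk X Y).
Proof.
move=> G H GH; apply/negb_inj; rewrite !hitNE.
by apply: eq_forallb => e; case: (boolP (e \in _)) => //= eB; rewrite GH.
Qed.

(** Avoiding [blk X Y] is a product event. For [x] in [X] and [y] in [Y], one of the two encodings
    [(x, y)], [(y, x)] is absent with probability [1 - p] and the other one surely; disjointness
    rules out [x = y]. *)
Lemma prob_no_hit p X Y : [disjoint X & Y] ->
  gnp_prob p (fun G => ~~ hit G X Y) = (1 - p) ^+ (#|X| * #|Y|).
Proof.
move=> dXY; rewrite gnp_probE.
pose F e b := wt p e b * (if e \in blk X Y then (~~ b)%:R else 1).
transitivity (\sum_(G : graph n) \prod_e F e (G e)).
  apply: eq_bigr => G _; rewrite big_split /=; congr (_ * _).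
  rewrite -big_mkcond /= hitNE; case: forall_inP => [h|nh].
    by rewrite big1 // => e /h ->.
  have /exists_inP[e eB Ge] : [exists e in blk X Y, G e].
    rewrite -[X in is_true X]negbK negb_exists_in; apply/negP => /forall_inP h.
    by apply: nh.
  by rewrite (bigD1 e) //= Ge mul0r.
rewrite sum_graph_prod.
pose c (e : 'I_n * 'I_n) := wt p e false.
transitivity (\prod_(e in blk X Y) c e).
  rewrite [RHS]big_mkcond; apply: eq_bigr => e _; rewrite /F.
  by case: ifP => _; rewrite ?mulr0 ?add0r ?mulr1 // wt_sum.
rewrite (eq_bigl (mem [predU finset.setX X Y & finset.setX Y X])); last first.
  by move=> e; rewrite !inE.
rewrite bigU /=; last first.
  rewrite -setI_eq0; apply/eqP/setP => -[x y]; rewrite !inE /=.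
  apply/negbTE/negP => /andP[/andP[xX _] /andP[xY _]].
  by rewrite (disjointFr dXY xX) in xY.
rewrite [X in _ * X](reindex_inj (can_inj (@swap_pairK _ _))) /=.
rewrite [X in _ * X](eq_bigl (mem (finset.setX X Y))); last first.
  by move=> [x y]; rewrite !inE /= andbC.
rewrite -big_split /= (eq_bigr (fun=> 1 - p)) => [|[x y]].
  by rewrite prodr_const cardsX.
rewrite inE /= => /andP[xX yY]; rewrite /c /wt /=.
case: (ltngtP x y) => [_|_|/val_inj exy]; rewrite ?mulr1 ?mul1r //.
by rewrite -exy (disjointFr dXY xX) in yY.
Qed.

Lemma prob_hit p X Y : [disjoint X & Y] ->
  gnp_prob p (fun G => hit G X Y) = 1 - (1 - p) ^+ (#|X| * #|Y|).
Proof.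
move=> dXY; rewrite -(prob_no_hit p dXY) gnp_probC.
by ring.
Qed.

End Expectation.

(** * Sprinkling, monotonicity and a tail bound for random sets *)

Section Sprinkling.
Variables (R : realType) (n : nat).
Implicit Types (p : R) (G H : graph n) (f g : graph n -> R).

Definition gunion G H : graph n := [ffun e => G e || H e].

(** Summing over the value [K] of the union makes everything a product over the edges, so that only
    an identity for two coins at one edge remains. *)
Lemma Ex_union p1 p2 f :
  Ex p1 (fun G => Ex p2 (fun H => f (gunion G H))) = Ex (p1 + p2 - p1 * p2) f.
Proof.
transitivity (\sum_(K : graph n) \sum_(G : graph n) \sum_(H : graph n)
   gnp_weight p1 G * gnp_weight p2 H * (K == gunion G H)%:R * f K).
  rewrite exchange_big; apply: eq_bigr => G _.
  rewrite exchange_big big_distrr /=; apply: eq_bigr => H _.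
  rewrite (bigD1 (gunion G H)) //= eqxx big1 => [|K /negbTE ->].
    by rewrite addr0 mulr1 mulrA.
  by rewrite mulr0 mul0r.
apply: eq_bigr => K _.
rewrite (eq_bigr (fun G => (\sum_(H : graph n) gnp_weight p1 G * gnp_weight p2 H *
  (K == gunion G H)%:R) * f K)); last by move=> G _; rewrite mulr_suml.
rewrite -mulr_suml; congr (_ * _).
pose F a (e : 'I_n * 'I_n) b := wt p1 e a * wt p2 e b * (K e == a || b)%:R.
transitivity (\sum_(G : graph n) \sum_(H : graph n) \prod_e F (G e) e (H e)).
  apply: eq_bigr => G _; apply: eq_bigr => H _; rewrite !big_split /=.
  congr (_ * _); case: eqP => [->|neK].
    by rewrite big1 // => e _; rewrite ffunE eqxx.
  have [e Ke] : exists e, K e != (G e || H e).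
    apply/existsP; rewrite -[X in is_true X]negbK negb_exists.
    apply/negP => /forallP h; apply: neK; apply/ffunP => e; rewrite ffunE.
    by have := h e; rewrite negbK => /eqP.
  by rewrite (bigD1 e) //= (negbTE Ke) mul0r.
rewrite (eq_bigr (fun G => \prod_e (F (G e) e true + F (G e) e false))); last first.
  by move=> G _; rewrite (sum_graph_prod (fun e b => F (G e) e b)).
rewrite (sum_graph_prod (fun e a => F a e true + F a e false)).
apply: eq_bigr => e _; rewrite /F /wt.
by case: (e.1 < e.2)%N; case: (K e); rewrite /=; ring.
Qed.

Definition increasing (A : pred (graph n)) := forall G H, A G -> A (gunion G H).

(** Coupling: the denser graph is the union of the sparser one and an independent graph of density
    [q] with [p2 = p1 + q - p1 * q]. Solving for [q] divides by [1 - p1], hence the separate case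
    [p1 = 1]. *)
Lemma gnp_prob_incr p1 p2 (A : pred (graph n)) : 0 <= p1 -> p1 <= p2 -> p2 <= 1 ->
  increasing A -> gnp_prob p1 A <= gnp_prob p2 A.
Proof.
move=> p10 p12 p21 mA.
have [p1e|p1n] := eqVneq p1 1.
  by have -> : p1 = p2 by apply/eqP; rewrite eq_le p12 p1e p21.
have p1lt : 0 < 1 - p1 by rewrite subr_gt0 lt_neqAle p1n (le_trans p12).
pose q := (p2 - p1) / (1 - p1).
have -> : p2 = p1 + q - p1 * q by rewrite /q; field; rewrite gt_eqF.
have hq : 0 <= q <= 1.
  rewrite /q divr_ge0 ?subr_ge0 ?(ltW p1lt) //= ?(le_trans p12) //.
  by rewrite ler_pdivrMr // mul1r lerD2r.
rewrite [leRHS]gnp_probE -Ex_union gnp_probE.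
apply: ler_Ex; first by rewrite p10 (le_trans p12).
move=> G; rewrite -{1}(Ex_cst n q (A G)%:R); apply: ler_Ex => // H.
by rewrite ler_nat; case: (A G) (mA G H) => // ->.
Qed.

(** The union of the two rounds has density [p1 + p2 - p1 * p2], at most [p], so monotonicity
    transfers the bound to [p]. All rounds of the lower bound are composed by this lemma. *)
Lemma sprinkle p1 p2 p (Q A : pred (graph n)) (h1 h2 : R) :
  0 <= p1 -> 0 <= p2 -> p1 + p2 <= p -> p <= 1 -> 0 <= h2 -> increasing A ->
  1 - h1 <= gnp_prob p1 Q ->
  (forall G, Q G -> 1 - h2 <= gnp_prob p2 (fun H => A (gunion G H))) ->
  1 - (h1 + h2) <= gnp_prob p A.
Proof.
move=> p10 p20 p12 ple1 h20 mA hQ hA.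
have q1 : 0 <= p1 <= 1 by lra.
have q2 : 0 <= p2 <= 1 by lra.
have p1p2 : 0 <= p1 * p2 by apply: mulr_ge0; lra.
have p1p2' : p1 * p2 <= p1 by rewrite ler_piMr; lra.
apply: le_trans (_ : gnp_prob (p1 + p2 - p1 * p2) A <= _); last first.
  by apply: gnp_prob_incr => //; lra.
rewrite gnp_probE -Ex_union.
apply: le_trans (_ : Ex p1 (fun G => (Q G)%:R - h2) <= _).
  by rewrite ExB Ex_cst -gnp_probE; lra.
apply: ler_Ex => // G.
have := hA G; case: (Q G) => [/(_ isT)|_].
  by rewrite gnp_probE /=; lra.
rewrite /= sub0r; apply: (@le_trans _ _ 0); first by lra.
by apply: Ex_ge0.
Qed.

Lemma sum_subset_pow (T : finType) (Y : {set T}) (c : R) :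
  \sum_(A : {set T} | A \subset Y) c ^+ #|A| = (1 + c) ^+ #|Y|.
Proof.
rewrite -prodr_const [RHS]big_mkcond /=.
rewrite (eq_bigr (fun i => (if i \in Y then c else 0) + 1)); last first.
  by move=> i _; case: ifP; rewrite ?add0r // addrC.
rewrite bigA_distr big_mkcond /=; apply: eq_bigr => A _.
case: ifPn => [/subsetP AY|/subsetPn[x xA xY]].
  rewrite -prodr_const big_mkcond /=; apply: eq_bigr => i _.
  by case: ifP => // /AY ->.
by rewrite (bigD1 x) //= xA (negbTE xY) mul0r.
Qed.

(** Replacing e by 4 = 1 + 3 allows an expansion over subsets with weights [3 ^+ #|A|] in the tail
    bound below. *)
Lemma expR_le4n m : expR m%:R <= 4 ^+ m :> R.
Proof.
rewrite -[m%:R]mulr1 expRM_natl lerXn2r ?nnegrE ?expR_ge0 //.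
have h : 2^-1 <= expR (- 2^-1) :> R.
  by apply: le_trans (expR_ge1Dx _); lra.
have -> : expR 1 = expR 2^-1 ^+ 2 :> R by rewrite -expRM_natl; congr expR; field.
have -> : 4 = 2 ^+ 2 :> R by ring.
rewrite lerXn2r ?nnegrE ?expR_ge0 //.
by rewrite expRN lef_pV2 ?posrE ?expR_gt0 in h.
Qed.

(* Markov's inequality for [4 ^ #|X|], expanded over the subsets of [X]. *)
Lemma random_set_tail p (T : finType) (X : graph n -> {set T}) (Y : {set T}) (th a : R) :
  0 <= p <= 1 -> 0 <= th -> (forall G, X G \subset Y) ->
  (forall A : {set T}, A \subset Y ->
     gnp_prob p (fun G => A \subset X G) <= th ^+ #|A|) ->
  gnp_prob p (fun G => a <= #|X G|%:R) <= expR (- a + 3 * th * #|Y|%:R).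
Proof.
move=> hp th0 XY hA.
apply: le_trans (_ : Ex p (fun G => expR (- a) * 4 ^+ #|X G|) <= _).
  rewrite gnp_probE; apply: ler_Ex => // G.
  case: (boolP (a <= _)) => [aX|_] /=; last by rewrite mulr_ge0 ?expR_ge0 ?exprn_ge0.
  apply: le_trans (_ : expR (- a) * expR #|X G|%:R <= _).
    by rewrite -expRD; apply: le_trans (expR_ge1Dx _); lra.
  by rewrite ler_wpM2l ?expR_ge0 ?expR_le4n.
rewrite ExZ expRD ler_wpM2l ?expR_ge0 //.
rewrite (@eq_Ex _ _ _ _ (fun G => \sum_(A : {set T} | A \subset Y)
   3 ^+ #|A| * (A \subset X G)%:R)); last first.
  move=> G; rewrite (_ : 4 = 1 + 3); last by ring.
  rewrite -sum_subset_pow big_mkcond [RHS]big_mkcond /=.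
  apply: eq_bigr => A _; case: (boolP (A \subset X G)) => AX.
    by rewrite (subset_trans AX (XY G)) mulr1.
  by rewrite mulr0 if_same.
rewrite Ex_sum.
apply: le_trans (_ : (1 + 3 * th) ^+ #|Y| <= _).
  rewrite -sum_subset_pow; apply: ler_sum => A AY.
  rewrite ExZ exprMn ler_wpM2l ?exprn_ge0 //.
  by rewrite -gnp_probE hA.
by rewrite expRM_natr lerXn2r ?nnegrE ?expR_ge0 ?expR_ge1Dx //; lra.
Qed.

End Sprinkling.

(** * Upper bound: encoding minors by forests *)

Lemma prob_all_indep (R : realType) (n : nat) (p : R) (J : finType) (P : pred J)
    (A : J -> pred (graph n)) (S : J -> {set 'I_n * 'I_n}) :
  (forall j, P j -> depends_on (A j) (S j)) ->
  (forall i j, P i -> P j -> i != j -> [disjoint S i & S j]) ->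
  gnp_prob p (fun G => [forall (j | P j), A j G]) = \prod_(j | P j) gnp_prob p (A j).
Proof.
move=> dA dS; rewrite gnp_probE.
transitivity (Ex p (fun G => \prod_(j <- enum P) (A j G)%:R)).
  apply: eq_Ex => G; rewrite big_enum.
  case: forall_inP => [h|nh]; first by rewrite big1 // => j /h ->.
  have /exists_inP[j Pj Aj] : [exists (j | P j), ~~ A j G].
    rewrite -[X in is_true X]negbK negb_exists_in; apply/negP => /forall_inP h.
    by apply: nh => j Pj; have := h j Pj; rewrite negbK.
  by rewrite (bigD1 j) //= (negbTE Aj) mul0r.
rewrite (@Ex_indep_prod _ _ _ _ _ _ S) ?enum_uniq //.
- by rewrite big_enum; apply: eq_bigr => j _; rewrite gnp_probE.
- by move=> j; rewrite mem_enum => /dA d G H /d ->.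
- by move=> i j; rewrite !mem_enum; exact: dS.
Qed.

Section ConnectedParent.
Variables (n : nat) (G : graph n).

(** Breadth-first tree: [t] holds the root, the parent map and the rank, which is the distance to
    the root inside [B]. The strict decrease of the rank makes the parent map acyclic; a shortest
    path has distinct vertices, so ranks stay below [n]. *)
Lemma connected_parent (B : {set 'I_n}) :
  B != finset.set0 -> induced_connected G B ->
  exists t : 'I_n * ('I_n -> 'I_n) * ('I_n -> nat),
    [/\ t.1.1 \in B, t.1.2 t.1.1 = t.1.1, forall v, v \in B -> (t.2 v < n)%N &
     forall v, v \in B -> v != t.1.1 ->
       [/\ t.1.2 v \in B, adj G v (t.1.2 v) & (t.2 (t.1.2 v) < t.2 v)%N]].
Proof.
case/set0Pn => r rB conB.
pose e := [rel u v | adj G u v && (u \in B) && (v \in B)].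
pose D v m := `[< exists s, [/\ path e r s, last r s = v & size s = m] >].
have Dex v : v \in B -> exists m, D v m.
  move=> vB; have /forall_inP/(_ r rB)/forall_inP/(_ v vB)/connectP[s ps ls] := conB.
  by exists (size s); apply/asboolP; exists s.
pose rk v := if pselect (exists m, D v m) is left h then ex_minn h else 0%N.
have rkP v : v \in B -> D v (rk v) /\ (forall m, D v m -> (rk v <= m)%N).
  move=> vB; rewrite /rk; case: pselect => [h|]; last by have := Dex v vB.
  by case: ex_minnP => m Dm mle; split.
have par v : v \in B -> v != r ->
    exists u, [/\ u \in B, adj G v u & (rk u < rk v)%N].
  move=> vB vr; have [/asboolP[s [ps ls ss]] _] := rkP v vB.
  case/lastP: s ps ls ss => [|s u]; first by move=> _ /= rv; rewrite rv eqxx in vr.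
  rewrite rcons_path last_rcons size_rcons => /andP[ps /= /andP[/andP[a uB] _]] uv ss.
  exists (last r s); split=> //; first by rewrite adj_sym -uv.
  rewrite -ss ltnS; apply: (rkP _ uB).2; apply/asboolP; by exists s.
have /choice[f fP] : forall v, exists u,
    if (v \in B) && (v != r) then [/\ u \in B, adj G v u & (rk u < rk v)%N]
    else u = v.
  by move=> v; case: (boolP (_ && _)) => [/andP[vB vr]|_]; [exact: par | exists v].
exists (r, f, rk) => /=; split=> //.
- by have := fP r; rewrite eqxx andbF.
- move=> v vB.
  have /forall_inP/(_ r rB)/forall_inP/(_ v vB)/connectP[s ps ls] := conB.
  case/shortenP: ps ls => s' ps' us' _ ls'.
  have : (rk v <= size s')%N.
    by apply: (rkP v vB).2; apply/asboolP; exists s'.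
  move=> h; apply: leq_ltn_trans h _.
  rewrite -[X in (_ < X)%N](card_ord n).
  by have := max_card (mem (r :: s')); rewrite (card_uniqP us').
- by move=> v vB vr; have := fP v; rewrite vB vr.
Qed.

End ConnectedParent.

Section ForestEncoding.
Variables (n : nat).
Implicit Types (U : {set 'I_n}) (f : {ffun 'I_n -> 'I_n}) (G : graph n).

(** Ranks in a tree are below [n], so [n] parent steps reach the root. *)
Definition top f v := iter n f v.
Definition tree_roots U f := [set v in U | f v == v].
Definition tree U f r := [set v in U | top f v == r].
(** A [top] that is constant along [f] separates tree edges from pairs of different trees; the
    absence of 2-cycles keeps the tree edges of distinct vertices distinct. *)
Definition forest f :=
  [forall v, (top f (f v) == top f v) && ((f v != v) ==> (f (f v) != v))].

(* Indices of the constraints imposed on the graph: [inl v] is the tree edge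
   from [v] to its parent, [inr (r, r')] the adjacency of two trees. *)
Definition constr U f (j : 'I_n + 'I_n * 'I_n) :=
  match j with
  | inl v => f v != v
  | inr (r, r') => [&& r \in tree_roots U f, r' \in tree_roots U f & (r < r')%N]
  end.
Definition lset U f (j : 'I_n + 'I_n * 'I_n) :=
  match j with inl v => [set v] | inr (r, _) => tree U f r end.
Definition rset U f (j : 'I_n + 'I_n * 'I_n) :=
  match j with inl v => [set f v] | inr (_, r) => tree U f r end.
Definition realized U f G :=
  [forall (j | constr U f j), hit G (lset U f j) (rset U f j)].

Lemma minor_forest G k : has_K_minor G k ->
  exists U f, [/\ forest f, #|tree_roots U f| = k & realized U f G].
Proof.
case=> B [B0 Bc Bd Ba].
have /choice[t tP] := fun h => connected_parent (B0 h) (Bc h).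
pose c v := [pick h | v \in B h].
have cP h v : v \in B h -> c v = Some h.
  move=> vh; rewrite /c; case: pickP => [h' vh'|/(_ h)]; last by rewrite vh.
  have [->//|hh] := eqVneq h' h.
  by rewrite (disjointFr (Bd _ _ hh) vh') in vh.
pose f : {ffun 'I_n -> 'I_n} := [ffun v => if c v is Some h then (t h).1.2 v else v].
have fP h v : v \in B h -> f v = (t h).1.2 v by move=> vh; rewrite ffunE (cP h).
have fN v : (forall h, v \notin B h) -> f v = v.
  by move=> vN; rewrite ffunE /c; case: pickP => // h; rewrite (negbTE (vN h)).
pose root h := (t h).1.1.
have rB h : root h \in B h by case: (tP h).
have fr h : f (root h) = root h by rewrite (fP h) //; case: (tP h).
have fB h v : v \in B h -> f v \in B h.
  move=> vh; have [->|vr] := eqVneq v (root h); first by rewrite fr.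
  by rewrite (fP h) //; case: (tP h) => _ _ _ /(_ v vh vr)[].
have itr m h : iter m f (root h) = root h by elim: m => //= m ->.
have topm m h v : v \in B h -> ((t h).2 v <= m)%N -> iter m f v = root h.
  elim: m v => [|m IH] v vh.
    rewrite leqn0 => /eqP rk0 /=; apply/eqP/negPn/negP => vr.
    by case: (tP h) => _ _ _ /(_ v vh vr)[_ _]; rewrite rk0.
  move=> rk; rewrite iterSr; have [->|vr] := eqVneq v (root h).
    by rewrite fr itr.
  apply: IH; first exact: fB.
  case: (tP h) => _ _ _ /(_ v vh vr)[_ _]; rewrite -(fP h) // => lt.
  by rewrite -ltnS (leq_trans lt).
have topB h v : v \in B h -> top f v = root h.
  move=> vh; apply: topm => //; apply: ltnW.
  by case: (tP h) => _ _ /(_ v vh).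
pose U := \bigcup_h B h.
have vcase v : (exists h, v \in B h) \/ (forall h, v \notin B h).
  case: (pickP (fun h => v \in B h)) => [h vh|vN]; first by left; exists h.
  by right=> h; rewrite vN.
have rootsE : tree_roots U f = [set root h | h : 'I_k].
  apply/setP => v; rewrite inE; apply/andP/imsetP => [[/bigcupP[h _ vh] /eqP fv]|[h _ ->]].
    exists h => //; rewrite -(topB h v vh) /top.
    have itf m : iter m f v = v by elim: m => //= m ->.
    by rewrite itf.
  by split; [apply/bigcupP; exists h|rewrite fr].
have rinj : injective root.
  by move=> h h' e; apply: Some_inj; rewrite -(cP h _ (rB h)) e (cP h').
have BT h : B h \subset tree U f (root h).
  apply/subsetP => v vh; rewrite inE (topB h) // eqxx andbT.
  by apply/bigcupP; exists h.
exists U, f; split.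
- apply/forallP => v; case: (vcase v) => [[h vh]|vN]; last by rewrite fN ?eqxx.
  rewrite (topB h) ?fB // (topB h) // eqxx /=; apply/implyP => fv.
  apply/eqP => ffv.
  have vr : v != root h by apply: contraNneq fv => ->; rewrite fr.
  have fvr : f v != root h.
    by apply: contraNneq vr => e; rewrite -ffv e fr.
  case: (tP h) => _ _ _ T.
  have [_ _] := T v vh vr; rewrite -(fP h) // => l1.
  have [_ _] := T (f v) (fB _ _ vh) fvr; rewrite -(fP h) ?fB // ffv => l2.
  by have := ltn_trans l1 l2; rewrite ltnn.
- by rewrite rootsE card_imset // card_ord.
apply/forall_inP => -[v|[r r']] /=.
  move=> fv; case: (vcase v) => [[h vh]|vN]; last by rewrite fN ?eqxx in fv.
  have vr : v != root h by apply: contraNneq fv => ->; rewrite fr.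
  case: (tP h) => _ _ _ /(_ v vh vr)[_ a _]; rewrite -(fP h) // in a.
  by apply/hitP; exists v, (f v); rewrite !inE.
rewrite rootsE => /and3P[/imsetP[h _ ->] /imsetP[h' _ ->] lt].
have hh : h != h' by apply: contraTneq lt => ->; rewrite ltnn.
have [x [y [xh yh a]]] := Ba h h' hh.
by apply/hitP; exists x, y; rewrite !(subsetP (BT _)).
Qed.

Lemma constr_disjoint U f j : forest f -> constr U f j ->
  [disjoint lset U f j & rset U f j].
Proof.
move=> /forallP F; case: j => [v|[r r']] /=.
  by move=> fv; rewrite disjoints1 inE eq_sym.
move=> /and3P[_ _ lt]; rewrite -setI_eq0; apply/eqP/setP => v; rewrite !inE.
apply/negbTE/negP => /andP[/andP[_ /eqP e1] /andP[_ /eqP e2]].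
by rewrite -e1 -e2 ltnn in lt.
Qed.

(** This makes the constraints independent. Both ends of a tree edge have the same [top], whereas a
    pair between two trees has different tops, which determine the two roots; two tree edges could
    coincide only through a 2-cycle of [f]. *)
Lemma constr_blk_disjoint U f i j : forest f -> constr U f i -> constr U f j -> i != j ->
  [disjoint blk (lset U f i) (rset U f i) & blk (lset U f j) (rset U f j)].
Proof.
move=> /forallP F ci cj ij.
have key e : e \in blk (lset U f i) (rset U f i) ->
    e \in blk (lset U f j) (rset U f j) -> False; last first.
  rewrite -setI_eq0; apply/eqP/setP => e; rewrite !inE.
  apply/negbTE/negP => /andP[]; move: (key e); rewrite !inE; exact.
case: e => x y; rewrite !inE /=.
wlog: x y / (x \in lset U f i) && (y \in rset U f i).
  move=> W /orP[] H; first by apply: (W x y); rewrite H.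
  case/andP: H => xR yL H'; apply: (W y x); rewrite ?xR ?yL ?orbT //.
  by case/orP: H' => /andP[-> ->]; rewrite ?orbT.
move=> xy _; move: xy.
have Ft v : top f (f v) = top f v by have /andP[/eqP] := F v.
case: i ci ij => [v|[r r']] /= ci ij.
  rewrite !inE => /andP[/eqP -> /eqP ->].
  case: j cj ij => [w|[r r']] /= cj ij.
    rewrite !inE => /orP[] /andP[/eqP e1 /eqP e2].
      by rewrite e1 eqxx in ij.
    by have /andP[_ /implyP/(_ ci)] := F v; rewrite e2 -e1 eqxx.
  case/and3P: cj => _ _ lt; rewrite !inE !Ft.
  by case/orP => /andP[/andP[_ /eqP e1] /andP[_ /eqP e2]]; move: lt;
     rewrite -e1 -e2 ltnn.
case/and3P: ci => _ _ lt; rewrite !inE => /andP[/andP[_ /eqP e1] /andP[_ /eqP e2]].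
case: j cj ij => [w|[s s']] /= cj ij.
  rewrite !inE => /orP[] /andP[/eqP e3 /eqP e4]; move: lt;
    by rewrite -e1 -e2 e3 e4 Ft ltnn.
case/and3P: cj => _ _ lt'; rewrite !inE.
case/orP => /andP[/andP[_ /eqP e3] /andP[_ /eqP e4]].
  by case/eqP: ij; rewrite -e1 -e2 e3 e4.
by move: lt lt'; rewrite -e1 -e2 e3 e4; case: ltngtP.
Qed.

End ForestEncoding.

(** * First moment bound over forests *)

Section UpperBound.
Variables (R : realType) (n : nat).
Implicit Types (U : {set 'I_n}) (f : {ffun 'I_n -> 'I_n}) (p : R).

Lemma prob_realized p U f : forest f ->
  gnp_prob p (realized U f) =
  \prod_(j | constr U f j) (1 - (1 - p) ^+ (#|lset U f j| * #|rset U f j|)).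
Proof.
move=> F.
rewrite (@prob_all_indep _ _ _ _ (constr U f)
  (fun j G => hit G (lset U f j) (rset U f j))
  (fun j => blk (lset U f j) (rset U f j))).
- by apply: eq_bigr => j cj; rewrite prob_hit ?constr_disjoint.
- by move=> j _; exact: hit_depends.
- by move=> i j ci cj; exact: constr_blk_disjoint.
Qed.

Lemma sum_offdiag (A : {set 'I_n}) (F : 'I_n -> 'I_n -> R) :
  (forall r r', F r r' = F r' r) ->
  \sum_(x | [&& x.1 \in A, x.2 \in A & x.1 != x.2]) F x.1 x.2 =
  2 * \sum_(x | [&& x.1 \in A, x.2 \in A & (x.1 < x.2)%N]) F x.1 x.2.
Proof.
move=> Fs; rewrite mulr_natl mulr2n.
rewrite (bigID (fun x : 'I_n * 'I_n => (x.1 < x.2)%N)) /=; congr (_ + _).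
  apply: eq_bigl => -[x y] /=; case: (x \in A); case: (y \in A) => //=.
  by rewrite neq_ltn; case: ltngtP.
rewrite [LHS](reindex_inj (can_inj (@swap_pairK _ _))) /=.
apply: eq_big => [[x y]|[x y] _] /=; last exact: Fs.
case: (x \in A); case: (y \in A) => //=.
rewrite (_ : (y != x) = (y != x :> nat)) // -leqNgt.
by case: ltngtP.
Qed.

Lemma card_offdiag (A : {set 'I_n}) :
  \sum_(x : 'I_n * 'I_n | [&& x.1 \in A, x.2 \in A & x.1 != x.2]) (1 : R) =
  #|A|%:R * (#|A|%:R - 1).
Proof.
transitivity (\sum_(r in A) \sum_(r' | (r' \in A) && (r != r')) (1 : R)).
  rewrite pair_big_dep /=; apply: eq_bigl => -[x y] /=.
  by rewrite andbA.
transitivity (\sum_(r in A) (#|A|%:R - 1 : R)); last by rewrite sumr_const -[LHS]mulr_natl.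
apply: eq_bigr => r rA; rewrite -sum1_card natr_sum (bigD1 r rA) /= [1 + _]addrC addrK.
by apply: eq_bigl => x; rewrite eq_sym.
Qed.

(* Convexity, through the tangent line of [x |-> expR (- mu * x)] at the upper
   bound [n ^ 2 / (k * (k - 1))] for the mean of [b r * b r']. *)
Lemma prod_tree_bound p mu (A : {set 'I_n}) (b : 'I_n -> nat) (k : nat) :
  0 <= p <= 1 -> 0 <= mu -> expR (- mu) <= 1 - p -> #|A| = k -> (1 < k)%N ->
  (\sum_(r in A) b r <= n)%N ->
  \prod_(x | [&& x.1 \in A, x.2 \in A & (x.1 < x.2)%N])
     (1 - (1 - p) ^+ (b x.1 * b x.2)) <=
  expR (- (2^-1 * (k%:R * (k%:R - 1))
            * expR (- (mu * (n%:R ^+ 2 / (k%:R * (k%:R - 1))))))).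
Proof.
move=> hp mu0 hmu kA k1 sb.
set K : R := k%:R * (k%:R - 1).
have K0 : 0 < K.
  have : 1 < k%:R :> R by rewrite ltr1n.
  by move=> ?; rewrite /K mulr_gt0; lra.
set a := n%:R ^+ 2 / K.
apply: le_trans (_ : expR (- \sum_(x | [&& x.1 \in A, x.2 \in A & (x.1 < x.2)%N])
   expR (- (mu * (b x.1 * b x.2)%:R))) <= _).
  rewrite -sumrN expR_sum; apply: ler_prod => x _.
  rewrite subr_ge0 exprn_ile1 ?subr_ge0 ?gerBl; try lra.
  apply: le_trans (expR_ge1Dx _); rewrite lerD2l lerN2.
  by rewrite -mulNr expRM_natr lerXn2r ?nnegrE ?expR_ge0 //; lra.
rewrite ler_expR lerN2.
have -> : \sum_(x | [&& x.1 \in A, x.2 \in A & (x.1 < x.2)%N])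
    expR (- (mu * (b x.1 * b x.2)%:R)) = 2^-1 *
   \sum_(x | [&& x.1 \in A, x.2 \in A & x.1 != x.2])
    expR (- (mu * (b x.1 * b x.2)%:R)).
  rewrite (sum_offdiag _ (F := fun r r' => expR (- (mu * (b r * b r')%:R)))).
    by rewrite mulrA mulVf ?mul1r // pnatr_eq0.
  by move=> r r'; rewrite [(b r' * _)%N]mulnC.
rewrite -mulrA ler_wpM2l ?invr_ge0 //.
apply: le_trans (_ : \sum_(x : 'I_n * 'I_n | [&& x.1 \in A, x.2 \in A & x.1 != x.2])
   (expR (- (mu * a)) * ((1 + mu * a) * 1 - mu * (b x.1 * b x.2)%:R)) <= _);
  last first.
  apply: ler_sum => x _.
  have -> : - (mu * (b x.1 * b x.2)%:R) =
     - (mu * a) + (mu * a - mu * (b x.1 * b x.2)%:R) by ring.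
  rewrite expRD ler_wpM2l ?expR_ge0 //.
  by apply: le_trans (expR_ge1Dx _); lra.
rewrite -big_distrr /= sumrB -!big_distrr /= card_offdiag kA -/K mulrC.
rewrite ler_wpM2l ?expR_ge0 //.
have sq : \sum_(x : 'I_n * 'I_n | [&& x.1 \in A, x.2 \in A & x.1 != x.2])
    (b x.1 * b x.2)%:R <= n%:R ^+ 2 :> R.
  apply: le_trans (_ : (\sum_(r in A) (b r)%:R) ^+ 2 <= _); last first.
    by rewrite -natr_sum lerXn2r ?nnegrE // ler_nat.
  rewrite expr2 big_distrlr /= pair_big /=.
  rewrite [leRHS](bigID (fun x => x.1 != x.2)) /=.
  rewrite (eq_bigl (fun x => (x.1 \in A) && (x.2 \in A) && (x.1 != x.2))); last first.
    by move=> x; rewrite andbA.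
  rewrite (eq_bigr (fun x => (b x.1)%:R * (b x.2)%:R)); last by move=> x _; rewrite natrM.
  by rewrite lerDl sumr_ge0 // => x _; rewrite mulr_ge0.
have aK : a * K = n%:R ^+ 2 by rewrite /a divfK // gt_eqF.
have : mu * \sum_(x : 'I_n * 'I_n | [&& x.1 \in A, x.2 \in A & x.1 != x.2])
    (b x.1 * b x.2)%:R <= mu * (a * K) by rewrite aK ler_wpM2l.
lra.
Qed.

(** Union bound over the pairs [(U, f)]: every tree edge has probability [p], and the pairs of trees
    are bounded by [E] uniformly. The choice of [U] costs [2 ^ n]; [mu] is an upper bound for
    [- ln (1 - p)]. *)
Lemma prob_K_minor_le p mu (k : nat) :
  0 <= p <= 1 -> 0 <= mu -> expR (- mu) <= 1 - p -> (1 < k)%N ->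
  gnp_prob p (fun G : graph n => `[< has_K_minor G k >]) <=
  (2 + 2 * (n%:R * p)) ^+ n *
  expR (- (2^-1 * (k%:R * (k%:R - 1))
            * expR (- (mu * (n%:R ^+ 2 / (k%:R * (k%:R - 1))))))).
Proof.
move=> hp mu0 hmu k1; set E := expR _.
pose good (Uf : {set 'I_n} * {ffun 'I_n -> 'I_n}) :=
  forest Uf.2 && (#|tree_roots Uf.1 Uf.2| == k).
apply: le_trans (_ : \sum_(Uf | good Uf) gnp_prob p (realized Uf.1 Uf.2) <= _).
  apply: le_trans (gnp_prob_exists _ _ hp).
  apply: gnp_prob_le => // G /asboolP/minor_forest[U [f [F rk Rz]]].
  by apply/existsP; exists (U, f); rewrite /good F rk eqxx Rz.
pose w f := \prod_(v | f v != v) p.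
apply: le_trans (_ : \sum_(Uf | good Uf) w Uf.2 * E <= _).
  apply: ler_sum => -[U f] /andP[/= F /eqP rk].
  rewrite prob_realized // big_sumType /=.
  apply: ler_pM.
  - apply: prodr_ge0 => v _; rewrite subr_ge0 exprn_ile1; lra.
  - apply: prodr_ge0 => -[r r'] _; rewrite subr_ge0 exprn_ile1; lra.
  - rewrite le_eqVlt; apply/orP; left; apply/eqP; apply: eq_bigr => v _.
    by rewrite !cards1 muln1 expr1; ring.
  rewrite (eq_big (fun x => [&& x.1 \in tree_roots U f, x.2 \in tree_roots U f & (x.1 < x.2)%N])
    (fun x => 1 - (1 - p) ^+ (#|tree U f x.1| * #|tree U f x.2|))).
  - apply: (prod_tree_bound (b := fun r => #|tree U f r|)) => //.
    rewrite -[leqRHS](card_ord n) -sum1_card.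
    rewrite (eq_bigr (fun r => \sum_(v | v \in tree U f r) 1)%N); last first.
      by move=> r _; rewrite sum1_card.
    rewrite (exchange_big_dep xpredT) //=; apply: leq_sum => v _.
    rewrite (bigID (pred1 (top f v))) /= [X in (_ + X)%N]big1; last first.
      by move=> r /andP[/andP[_ ]]; rewrite inE => /andP[_ /eqP ->]; rewrite eqxx.
    rewrite addn0 (leq_trans (_ : _ <= \sum_(r | r == top f v) 1)%N) //.
      rewrite big_mkcond [X in (_ <= X)%N]big_mkcond.
      by apply: leq_sum => r _; case: ifP => // /andP[_ ->].
    by rewrite big_pred1_eq.
  - by case.
  - by case.
rewrite -big_distrl /= ler_wpM2r ?expR_ge0 //.
have p0 : 0 <= p by lra.
apply: le_trans (_ : \sum_(Uf : {set 'I_n} * {ffun 'I_n -> 'I_n}) w Uf.2 <= _).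
  rewrite [leRHS](bigID good) /= lerDl sumr_ge0 // => i _.
  by apply: prodr_ge0.
rewrite -(pair_big xpredT xpredT (fun (U : {set 'I_n}) f => w f)) /=.
have -> : (2 + 2 * (n%:R * p)) ^+ n = (1 + 1) ^+ #|[set: 'I_n]| * (1 + n%:R * p) ^+ n.
  by rewrite cardsT card_ord -exprMn; congr (_ ^+ _); ring.
rewrite -sum_subset_pow big_distrl /= big_mkcond [leRHS]big_mkcond /=.
apply: ler_sum => U _; rewrite finset.subsetT expr1n mul1r.
pose F (v u : 'I_n) := if u != v then p else 1.
rewrite (eq_bigr (fun f : {ffun 'I_n -> 'I_n} => \prod_v F v (f v))); last first.
  by move=> f _; rewrite /w big_mkcond.
(* The sum over all maps factorises: a vertex is a fixed point, with weight 1, or picks another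
   vertex as parent, with weight [p]. *)
rewrite -(bigA_distr_bigA F) -[X in _ <= _ ^+ X](card_ord n) -prodr_const.
apply: ler_prod => v _; rewrite sumr_ge0 /=; last first.
  by move=> u _; rewrite /F; case: ifP.
rewrite (bigD1 v) //= {1}/F eqxx lerD2l.
apply: le_trans (_ : \sum_(u < n) p <= _).
  rewrite big_mkcond; apply: ler_sum => u _; rewrite /F.
  by case: (u != v).
rewrite sumr_const card_ord mulr_natl //.
Qed.

End UpperBound.

(** * Branch sets, long paths and connectors *)

Section Deterministic.
Variables (n : nat).
Implicit Types (G H K : graph n) (X Y : {set 'I_n}).

Lemma sub_hit G X X' Y Y' : X \subset X' -> Y \subset Y' -> hit G X Y -> hit G X' Y'.
Proof.
move=> /subsetP XX /subsetP YY /hitP[x [y [xX yY a]]].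
by apply/hitP; exists x, y; split; [exact: XX|exact: YY|].
Qed.

Lemma ex_subset_card X m : (m <= #|X|)%N -> exists2 Y : {set 'I_n}, Y \subset X & #|Y| = m.
Proof.
move=> mX; exists [set x in take m (enum X)].
  by apply/subsetP => x; rewrite inE => /mem_take; rewrite mem_enum.
by rewrite cardsE (card_uniqP _) ?take_uniq ?enum_uniq // size_take -cardE; case: ltngtP mX.
Qed.

Definition rest (S : {set 'I_n}) (u : seq 'I_n) := ~: (S :|: [set x in u]).

(* Depth-first search: [S] is the set of finished vertices and [u] the stack;
   there is no edge between [S] and the unexplored vertices, and each move
   lowers the difference of their numbers by one. *)
Lemma dfs_balanced G j (S : {set 'I_n}) (u : seq 'I_n) :
  uniq u -> sorted (adj G) u -> [disjoint S & u] ->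
  ~~ hit G S (rest S u) -> #|rest S u| = (#|S| + j)%N ->
  exists (S' : {set 'I_n}) (u' : seq 'I_n),
    [/\ uniq u', sorted (adj G) u', [disjoint S' & u'],
        ~~ hit G S' (rest S' u') & #|rest S' u'| = #|S'|].
Proof.
elim: j S u => [|j IH] S u uu su dSu nh cT.
  by exists S, u; split=> //; rewrite addn0 in cT.
have inT v : (v \in rest S u) = (v \notin S) && (v \notin u).
  by rewrite !inE negb_or.
have [v vT] : exists v, v \in rest S u by apply/set0Pn; rewrite -card_gt0 cT addnS.
have grow x : x \in rest S u -> sorted (adj G) (x :: u) ->
  exists (S' : {set 'I_n}) (u' : seq 'I_n),
    [/\ uniq u', sorted (adj G) u', [disjoint S' & u'],
        ~~ hit G S' (rest S' u') & #|rest S' u'| = #|S'|].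
  move=> xT sxu; move: (xT); rewrite inT => /andP[xS xu].
  have restE : rest S (x :: u) = rest S u :\ x.
    by apply/setP => y; rewrite !inE; case: (y == x); case: (y \in S).
  apply: (IH S (x :: u)) => //=.
  - by rewrite xu.
  - by rewrite disjoint_sym disjoint_cons xS disjoint_sym.
  - by apply: contra nh; apply: sub_hit => //; rewrite restE subsetDl.
  - by move: cT; rewrite restE (cardsD1 x (rest S u)) xT add1n addnS => -[].
case: u uu su dSu nh cT inT vT grow => [|x u] uu su dSu nh cT inT vT grow.
  exact: grow vT _.
case: (boolP [exists y in rest S (x :: u), adj G y x]) => [/exists_inP[y yT a]|nx].
  by apply: (grow y) => //=; rewrite a.
have xS : x \notin S by rewrite (disjointFl dSu) // inE eqxx.
move: uu => /= /andP[xu uu].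
have restE : rest (x |: S) u = rest S (x :: u).
  by apply/setP => y; rewrite !inE; case: (y == x); case: (y \in S).
apply: (IH (x |: S) u) => //.
- by apply: path_sorted su.
- apply/pred0P => y; rewrite /= in_setU1.
  apply/negbTE/negP => /andP[/orP[/eqP->|yS] yu]; first by rewrite yu in xu.
  by move: (disjointFr dSu yS); rewrite inE yu orbT.
- rewrite restE; apply/negP => /hitP[y [z [yS zT a]]]; move: yS; rewrite in_setU1.
  case/orP => [/eqP yx|yS].
    by move/exists_inP: nx; apply; exists z => //; rewrite adj_sym -yx.
  by move/hitP: nh; apply; exists y, z.
- by rewrite restE cT cardsU1 xS; lia.
Qed.

(** The search starts with [n] unexplored and no finished vertices. At the balanced moment these two
    classes span no edge, so both are smaller than [m]; all other vertices are on the stack, which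
    is a path. *)
Lemma long_path G m :
  (forall X Y, [disjoint X & Y] -> #|X| = m -> #|Y| = m -> hit G X Y) ->
  exists u, [/\ uniq u, sorted (adj G) u & (n <= size u + 2 * m)%N].
Proof.
move=> hG.
have [] := @dfs_balanced G n finset.set0 [::].
- by [].
- by [].
- by apply/pred0P => x; rewrite /= inE.
- by apply/hitP => -[x [y []]]; rewrite inE.
- rewrite cards0 add0n -[RHS](card_ord n) -cardsT; congr #|pred_of_set _|.
  by apply/setP => x; rewrite !inE.
move=> S [u [uu su dSu nh cT]]; exists u; split=> //.
have Sm : (#|S| < m)%N.
  rewrite ltnNge; apply/negP => mS.
  have [X XS cX] := ex_subset_card mS.
  have [|Y YT cY] := @ex_subset_card (rest S u) m; first by rewrite cT.
  move/negP: nh; apply; apply: (sub_hit XS YT); apply: hG => //.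
  rewrite -setI_eq0; apply/eqP/setP => x; rewrite !inE.
  apply/negbTE/negP => /andP[/(subsetP XS) xS /(subsetP YT)].
  by rewrite !inE xS.
have : (#|S :|: [set x in u]| + #|rest S u| = n)%N by rewrite cardsC card_ord.
have := (leq_card_setU S [set x in u]).1.
rewrite cT [#|[set x in u]|]cardsE (card_uniqP uu) => h1 h2.
rewrite -{1}h2 (leq_trans (leq_add h1 (leqnn _))) //; move: #|S| (size u) Sm => a c am; clear -am; lia.
Qed.

Lemma induced_connectedP G X :
  reflect (forall x y, x \in X -> y \in X ->
     connect [rel u v | adj G u v && (u \in X) && (v \in X)] x y)
  (induced_connected G X).
Proof.
apply: (iffP forall_inP) => [h x y xX yX|h x xX]; last first.
  by apply/forall_inP => y yX; apply: h.
by have /forall_inP/(_ y yX) := h x xX.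
Qed.

Lemma induced_connectedU G X Y : induced_connected G X -> induced_connected G Y ->
  hit G X Y -> induced_connected G (X :|: Y).
Proof.
move=> /induced_connectedP cX /induced_connectedP cY /hitP[a [b [aX bY ab]]].
pose e := [rel u v | adj G u v && (u \in X :|: Y) && (v \in X :|: Y)].
have es : connect_sym e.
  apply: sym_connect_sym => u v /=; rewrite adj_sym.
  by rewrite -!andbA [(u \in _) && _]andbC.
have sX x y : x \in X -> y \in X -> connect e x y.
  move=> xX yX; apply: connect_sub (cX x y xX yX) => u v /=.
  by case/andP => /andP[g uX] vX; apply: connect1; rewrite /= g !inE uX vX.
have sY x y : x \in Y -> y \in Y -> connect e x y.
  move=> xX yX; apply: connect_sub (cY x y xX yX) => u v /=.
  by case/andP => /andP[g uX] vX; apply: connect1; rewrite /= g !inE uX vX !orbT.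
have cab : connect e a b by apply: connect1; rewrite /= ab !inE aX bY orbT.
have toa x : x \in X :|: Y -> connect e a x.
  rewrite inE => /orP[xX|xY]; first exact: sX.
  by apply: connect_trans cab _; apply: sY.
apply/induced_connectedP => x y /toa xa /toa ya.
by rewrite -/e in xa ya *; rewrite es in xa; apply: connect_trans xa ya.
Qed.

Lemma induced_connected1 G x : induced_connected G [set x].
Proof. by apply/induced_connectedP => y z /set1P -> /set1P ->. Qed.

Lemma induced_connected_seq G u : sorted (adj G) u -> induced_connected G [set x in u].
Proof.
elim: u => [_|x u IH su]; first by apply/induced_connectedP => y; rewrite inE.
have -> : [set y in x :: u] = [set x] :|: [set y in u].
  by apply/setP => y; rewrite !inE.
have su' := path_sorted su; case: u su IH su' => [|y u] /= su IH su'.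
  have -> : [set y in [::]] = finset.set0 :> {set 'I_n} by apply/setP => y; rewrite !inE.
  by rewrite finset.setU0 induced_connected1.
apply: induced_connectedU; [exact: induced_connected1|exact: IH|].
case/andP: su => a _.
by apply/hitP; exists x, y; rewrite !inE !eqxx.
Qed.

Definition gsub G K := forall e, G e -> K e.

Lemma gsub_adj G K x y : gsub G K -> adj G x y -> adj K x y.
Proof. by move=> GK /orP[] /GK e; rewrite /adj e ?orbT. Qed.

Lemma gsub_hit G K X Y : gsub G K -> hit G X Y -> hit K X Y.
Proof.
move=> GK /hitP[x [y [xX yY a]]]; apply/hitP; exists x, y.
by split=> //; exact: gsub_adj a.
Qed.

Lemma gsub_sorted G K u : gsub G K -> sorted (adj G) u -> sorted (adj K) u.
Proof. by move=> GK; apply: sub_sorted => x y; exact: gsub_adj. Qed.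

Lemma gsub_connected G K X : gsub G K -> induced_connected G X -> induced_connected K X.
Proof.
move=> GK /induced_connectedP c; apply/induced_connectedP => x y xX yX.
apply: connect_sub (c x y xX yX) => u v /= /andP[/andP[a uX] vX].
by apply: connect1; rewrite /= (gsub_adj GK a) uX vX.
Qed.

Lemma gsubUl G H : gsub G (gunion G H).
Proof. by move=> e; rewrite ffunE => ->. Qed.
Lemma gsubUr G H : gsub H (gunion G H).
Proof. by move=> e; rewrite ffunE orbC => ->. Qed.

(** * States of the construction and their repair by connectors *)

Section State.
Variable k : nat.
Implicit Types (B C : 'I_k -> {set 'I_n}) (w : seq 'I_n) (S : {set 'I_k * 'I_k}).

(* The [B i] are the cores of the branch sets [C i], the path [w] is the pool of
   unused vertices, and [S] contains the pairs of branch sets still to be joined. *)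
Definition state G b B C w S :=
  [/\ forall i, B i \subset C i, forall i, #|B i| = b,
      forall i, induced_connected G (C i),
      forall i j, i != j -> [disjoint C i & C j] &
      [/\ uniq w, sorted (adj G) w, forall i, [disjoint C i & w] &
      forall i j : 'I_k, (i < j)%N -> (i, j) \notin S -> hit G (C i) (C j)]].

Lemma state_gsub G K b B C w S : gsub G K -> state G b B C w S -> state K b B C w S.
Proof.
move=> GK [BC cB cC dC [uw sw dw hS]]; split=> //.
  by move=> i; apply: gsub_connected (cC i).
by split=> // [|i j ij nS]; [exact: gsub_sorted sw|apply: gsub_hit (hS i j ij nS)].
Qed.

Lemma state_minor G b B C w S : (0 < b)%N -> state G b B C w S -> S = finset.set0 ->
  has_K_minor G k.
Proof.
move=> b0 [BC cB cC dC [_ _ _ hS]] S0; exists C; split=> //.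
  move=> i; rewrite -card_gt0 (leq_trans b0) // -(cB i).
  exact: subset_leq_card.
move=> i j; rewrite neq_ltn => /orP[] ij.
  by apply/hitP/hS; rewrite // S0 inE.
by apply/hitP; rewrite hitC; apply: hS; rewrite // S0 inE.
Qed.

Definition inner S (Q : {set 'I_k}) := [set e in S | (e.1 \in Q) && (e.2 \in Q)].
Definition reduce S Q := if #|inner S Q| == 1%N then S :\: inner S Q else S.

Lemma reduce_sub S Q : reduce S Q \subset S.
Proof. by rewrite /reduce; case: ifP => // _; exact: subsetDl. Qed.

(** The connector is absorbed by [C e.1]: its edge to [B e.1] keeps that set connected and its edge
    to [B e.2] joins the pair. The cores never change, so later rounds meet sets of the same size
    [b]. Used or not, the [s] vertices leave the pool. *)
Lemma state_reduce G b B C w S (s : nat) (Q : {set 'I_k}) :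
  state G b B C w S -> (forall e, e \in S -> (e.1 < e.2)%N) ->
  (forall i, i \in Q -> hit G [set x in take s w] (B i)) ->
  exists C', state G b B C' (drop s w) (reduce S Q).
Proof.
move=> [BC cB cC dC [uw sw dw hS]] Slt hQ.
pose P := [set x in take s w].
have swd : sorted (adj G) (drop s w) by exact: drop_sorted.
have dd i : [disjoint C i & drop s w].
  by apply: disjointWr (dw i); apply/subsetP => x; exact: mem_drop.
have dP i : [disjoint C i & P].
  by apply: disjointWr (dw i); apply/subsetP => x; rewrite inE; exact: mem_take.
rewrite /reduce; case: ifP => [/cards1P[e eE]|_]; last first.
  by exists C; split=> //; split=> //; exact: drop_uniq.
have : e \in inner S Q by rewrite eE inE.
rewrite !inE => /and3P[eS e1Q e2Q].
pose C' i := if i == e.1 then C i :|: P else C i.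
have CC i : C i \subset C' i by rewrite /C'; case: ifP => // _; exact: subsetUl.
exists C'; split=> //.
- by move=> i; apply: subset_trans (BC i) (CC i).
- move=> i; rewrite /C'; case: eqP => [->|_] //.
  apply: induced_connectedU => //; first by apply/induced_connected_seq/take_sorted.
  by rewrite hitC; apply: sub_hit (hQ _ e1Q).
- move=> i j ij; rewrite /C'.
  case: eqP => [ie|_]; case: eqP => [je|_]; last exact: dC.
  + by rewrite ie je eqxx in ij.
  + by rewrite disjoints_subset subUset -!disjoints_subset dC // disjoint_sym dP.
  + by rewrite disjoint_sym disjoints_subset subUset -!disjoints_subset disjoint_sym dC // disjoint_sym dP.
split=> //.
- exact: drop_uniq.
- move=> i; rewrite /C'; case: ifP => // _.
  rewrite disjoint_subset; apply/subsetP => x; rewrite !inE => /orP[xC|xt].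
    by rewrite (disjointFr (dd i) xC).
  have := uw; rewrite -{1}(cat_take_drop s w) cat_uniq => /and3P[_ /hasPn h _].
  by apply: contraL xt => /h.
move=> i j ij; rewrite eE !inE negb_and negbK => /orP[/eqP ije|nS]; last first.
  by apply: sub_hit (hS i j ij nS).
have [ie je] : i = e.1 /\ j = e.2 by rewrite -ije.
apply: sub_hit (hQ e.2 e2Q).
  by rewrite /C' ie eqxx subsetUr.
by rewrite -je; apply: subset_trans (BC j) (CC j).
Qed.

Definition seg s w j := [set x in take s (drop (j * s) w)].
Definition hits G B s w j := [set i | hit G (seg s w j) (B i)].
(** Connector [j] is a fixed segment of [w], whether or not earlier ones were used. Different
    connectors thus examine disjoint sets of edges, and each is independent of the history before
    it. *)
Definition process G B s w N S :=
  foldl (fun S j => reduce S (hits G B s w j)) S (iota 0 N).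

Lemma processS G B s w N S :
  process G B s w N.+1 S = reduce (process G B s w N S) (hits G B s w N).
Proof. by rewrite /process -[N.+1]addn1 iotaD foldl_cat. Qed.

Lemma process_sub G B s w N S : process G B s w N S \subset S.
Proof.
elim: N => [|N IH]; first by rewrite /process.
by rewrite processS; apply: subset_trans IH; exact: reduce_sub.
Qed.

Lemma state_process G H b B C w S s N :
  state G b B C w S -> (forall e, e \in S -> (e.1 < e.2)%N) ->
  exists C', state (gunion G H) b B C' (drop (N * s) w) (process H B s w N S).
Proof.
move=> sG Slt; elim: N => [|N [C' IH]].
  by exists C; rewrite mul0n drop0; apply: state_gsub sG; exact: gsubUl.
rewrite processS mulSn -drop_drop.
apply: state_reduce IH _ _.
  by move=> e /(subsetP (process_sub _ _ _ _ _ _))/Slt.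
move=> i; rewrite inE; apply: gsub_hit; exact: gsubUr.
Qed.

End State.
End Deterministic.

(** * Probability of repairing a pair of branch sets *)

Lemma depends_on_comp n (U V : Type) (f : graph n -> U) (g : U -> V) S :
  depends_on f S -> depends_on (fun G => g (f G)) S.
Proof. by move=> fS G H /fS ->. Qed.

Lemma index_seg (T : eqType) (w : seq T) m s x : uniq w -> x \in take s (drop m w) ->
  (m <= index x w < m + s)%N.
Proof.
move=> uw xs; have mw : (m < size w)%N.
  by rewrite ltnNge; apply/negP => h; rewrite drop_oversize // in xs.
have := uw; rewrite -{1}(cat_take_drop m w) cat_uniq => /and3P[_ /hasPn h _].
have xd : x \in drop m w by exact: mem_take xs.
have /negbTE xt : x \notin take m w by exact: h.
have -> : index x w = (m + index x (drop m w))%N.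
  by rewrite -{1}(cat_take_drop m w) index_cat xt size_take mw.
have -> : index x (drop m w) = index x (take s (drop m w)).
  by rewrite -{1}(cat_take_drop s (drop m w)) index_cat xs.
rewrite leq_addr ltn_add2l.
have := xs; rewrite -index_mem size_take; case: ifP => // /negbT; rewrite -leqNgt.
by move=> h1 h2; apply: leq_trans h2 h1.
Qed.

Definition hit_rate (R : realType) (p : R) (m : nat) : R := 1 - (1 - p) ^+ m.

Section Process.
Variables (R : realType) (n k : nat) (B : 'I_k -> {set 'I_n}) (w : seq 'I_n).
Variables (s b : nat) (p : R).
Hypotheses (dB : forall i j, i != j -> [disjoint B i & B j])
  (cB : forall i, #|B i| = b) (uw : uniq w) (dw : forall i, [disjoint B i & w])
  (hp : 0 <= p <= 1).
Implicit Types (S A : {set 'I_k * 'I_k}).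

Local Notation rho := (hit_rate p (s * b)).
Local Notation BB := (\bigcup_i B i).
Local Notation Z j := (blk (seg s w j) BB).

Lemma rho_bounds : 0 <= rho <= 1.
Proof.
have hp1 := hp; have q0 : 0 <= 1 - p by lra.
have := exprn_ge0 (s * b) q0.
have : (1 - p) ^+ (s * b) <= 1 by apply: exprn_ile1; lra.
by rewrite /hit_rate; lra.
Qed.

Lemma seg_mem j x : x \in seg s w j -> x \in w.
Proof. by rewrite inE => /mem_take/mem_drop. Qed.

Lemma seg_disjoint (i j : nat) : i != j -> [disjoint seg s w i & seg s w j].
Proof.
move=> ij; apply/pred0P => x /=; apply/negbTE/negP; rewrite !inE.
case/andP=> /(index_seg uw)/andP[a1 a2] /(index_seg uw)/andP[b1 b2].
move: (index x w) a1 a2 b1 b2 => t a1 a2 b1 b2.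
by case: (ltngtP i j) ij => // ij _; have := leq_mul ij (leqnn s);
  rewrite mulSn; clear -a1 a2 b1 b2; lia.
Qed.

Lemma seg_B j i : [disjoint seg s w j & B i].
Proof.
apply/pred0P => x /=; apply/negbTE/negP => /andP[/seg_mem xw xB].
by rewrite (disjointFr (dw i) xB) in xw.
Qed.

Lemma card_seg j N : (N * s <= size w)%N -> (j < N)%N -> #|seg s w j| = s.
Proof.
move=> Nw jN; rewrite cardsE (card_uniqP _) ?take_uniq ?drop_uniq //.
rewrite size_takel // size_drop.
by apply: leq_trans (leq_sub2r (j * s) Nw); rewrite -mulnBl leq_pmull ?subn_gt0.
Qed.

Lemma Z_disjoint (i j : nat) : i != j -> [disjoint Z i & Z j].
Proof.
move=> ij; apply/pred0P => -[x y] /=; apply/negbTE/negP; rewrite !(in_setU, in_setX) /=.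
have dBs l z : z \in seg s w l -> z \notin BB.
  by move=> zs; apply/negP => /bigcupP[u _]; rewrite (disjointFr (seg_B l u) zs).
have dss z : z \in seg s w i -> z \notin seg s w j.
  by move=> zs; rewrite (disjointFr (seg_disjoint ij) zs).
case/andP => /orP[] /andP[h1 h2] /orP[] /andP[h3 h4].
- by have := dss _ h1; rewrite h3.
- by have := dBs _ _ h1; rewrite h3.
- by have := dBs _ _ h3; rewrite h1.
- by have := dss _ h2; rewrite h4.
Qed.

Lemma hits_depends j : depends_on (fun G => hits G B s w j) (Z j).
Proof.
move=> G H GH; apply/setP => i; rewrite !inE.
apply: (hit_depends (X := seg s w j) (Y := B i)) => -[x y] eB; apply: GH.
have sBB : {subset B i <= BB} by move=> z zB; apply/bigcupP; exists i.
by move: eB; rewrite !(in_setU, in_setX) => /orP[] /andP[h1 h2];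
  [rewrite h1 (sBB _ h2)|rewrite (sBB _ h1) h2 orbT].
Qed.

Lemma process_depends N S :
  depends_on (fun G => process G B s w N S) (\bigcup_(j < N) Z j).
Proof.
move=> G H GH; elim: N GH => [|N IH] GH //.
rewrite !processS IH => [|e /bigcupP[j _ ej]]; last first.
  by apply: GH; apply/bigcupP; exists (widen_ord (leqnSn N) j).
congr (reduce _ _); apply: (hits_depends (j := N)) => e eZ.
by apply: GH; apply/bigcupP; exists ord_max.
Qed.

Section OneConnector.
Variables (j N : nat).
Hypotheses (Nw : (N * s <= size w)%N) (jN : (j < N)%N).

Lemma prob_sub_hits (I : {set 'I_k}) :
  gnp_prob p (fun G => I \subset hits G B s w j) = rho ^+ #|I|.
Proof.
transitivity (gnp_prob p (fun G => [forall (i | i \in I), hit G (seg s w j) (B i)])).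
  rewrite !gnp_probE; apply: eq_Ex => G; congr (nat_of_bool _)%:R.
  apply/subsetP/forall_inP => h i /h; by rewrite inE.
rewrite (@prob_all_indep _ _ _ _ (mem I) (fun i G => hit G (seg s w j) (B i))
  (fun i => blk (seg s w j) (B i))).
- rewrite (eq_bigr (fun=> rho)) ?prodr_const // => i _.
  by rewrite prob_hit ?seg_B // cB (card_seg Nw).
- by move=> i _; exact: hit_depends.
move=> i i' _ _ ii'; apply/pred0P => -[x y] /=; apply/negbTE/negP;
  rewrite !(in_setU, in_setX) /=.
have sB z l : z \in seg s w j -> z \in B l -> False.
  by move=> zs; rewrite (disjointFr (seg_B j l) zs).
have BB' z : z \in B i -> z \in B i' -> False.
  by move=> zs; rewrite (disjointFr (dB ii') zs).
case/andP => /orP[] /andP[h1 h2] /orP[] /andP[h3 h4].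
- exact: BB' h2 h4.
- exact: sB h1 h3.
- exact: sB h3 h1.
- exact: BB' h1 h3.
Qed.

Definition ends (e : 'I_k * 'I_k) := [set e.1; e.2].
Definition star S i := [set e in S | (e.1 == i) || (e.2 == i)].

Lemma innerP S Q e : e \in S -> (e \in inner S Q) = (ends e \subset Q).
Proof. by move=> eS; rewrite inE eS /= subUset !sub1set. Qed.

Lemma card_ends_pair (e f : 'I_k * 'I_k) : (e.1 < e.2)%N -> (f.1 < f.2)%N -> f != e ->
  (3 <= #|ends e :|: ends f|)%N.
Proof.
case: e f => [e1 e2] [f1 f2] /= le lf fe.
have ce : #|ends (e1, e2)| = 2%N.
  by rewrite cards2 /=; case: eqP le => //= ->; rewrite ltnn.
rewrite -[X in (X <= _)%N]addn1 -ce addn1; apply: proper_card.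
rewrite properE subsetUl subUset subxx /=; apply: contra fe.
rewrite subUset !sub1set !inE /=.
by case/andP => /orP[] /eqP E1 /orP[] /eqP E2; subst; rewrite ?ltnn // in lf *;
  move: (ltn_trans le lf); rewrite ltnn.
Qed.

Lemma card_ends_disjoint (e f : 'I_k * 'I_k) : (e.1 < e.2)%N -> (f.1 < f.2)%N ->
  e.1 != f.1 -> e.1 != f.2 -> e.2 != f.1 -> e.2 != f.2 ->
  #|ends e :|: ends f| = 4%N.
Proof.
case: e f => [e1 e2] [f1 f2] /= le lf h1 h2 h3 h4.
rewrite cardsU !cards2 /= !neq_ltn le lf /= (_ : _ :&: _ = finset.set0) ?cards0 //.
apply/setP => x; rewrite !inE /=; apply/negbTE/negP.
by case/andP => /orP[] /eqP -> ; apply/negP; rewrite negb_or ?h1 ?h2 ?h3 ?h4.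
Qed.

(** Given that one pair is seen, [small] bounds by 1/2 the expected number of other pairs of [S]
    seen: at most [2 * D] of them share an end with it and cost one more factor [rho], the at most
    [r] others cost [rho ^+ 2]. *)
Variables (S : {set 'I_k * 'I_k}) (r D : R).
Hypotheses (Slt : forall e, e \in S -> (e.1 < e.2)%N) (cS : #|S|%:R <= r)
  (dS : forall i, #|star S i|%:R <= D) (small : 2 * D * rho + r * rho ^+ 2 <= 2^-1).

(* Bonferroni: besides [e], another pair of [S] seen by the connector involves at
   least one further branch set, and two of them unless it meets [e]. *)
Lemma prob_inner1 (S' : {set 'I_k * 'I_k}) e : S' \subset S -> e \in S' ->
  rho ^+ 2 / 2 <= gnp_prob p (fun G => inner S' (hits G B s w j) == [set e]).
Proof.
move=> S'S eS'; have eS := subsetP S'S _ eS'.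
have [r0 r1] : 0 <= rho /\ rho <= 1 by have := rho_bounds; lra.
apply: le_trans (_ : Ex p (fun G => (ends e \subset hits G B s w j)%:R -
   \sum_(f in S' :\ e) (ends e :|: ends f \subset hits G B s w j)%:R) <= _); last first.
  rewrite gnp_probE; apply: ler_Ex => // G; set H := hits _ _ _ _ _.
  case: (boolP (ends e \subset H)) => eH; last first.
    by rewrite /= sub0r (@le_trans _ _ 0) // oppr_le0 sumr_ge0.
  case: (boolP (inner S' H == [set e])) => [_|ne].
    by rewrite /= lerBlDr lerDl sumr_ge0.
  rewrite /= subr_le0.
  have [f fI fe] : exists2 f, f \in inner S' H & f != e.
    apply/exists_inP; apply: contraNT ne; rewrite negb_exists_in => /forall_inP h.
    rewrite eqEsubset sub1set innerP // eH andbT.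
    by apply/subsetP => f /h; rewrite negbK inE.
  have fS : f \in S' by move: fI; rewrite inE => /andP[].
  rewrite (bigD1 f) /=; last by rewrite !inE fe fS.
  by rewrite subUset eH /= -(innerP _ fS) fI lerDl sumr_ge0.
rewrite ExB Ex_sum -gnp_probE prob_sub_hits.
have -> : #|ends e| = 2%N.
  by rewrite cards2; have := Slt eS; case: eqP => //= ->; rewrite ltnn.
suff : \sum_(f in S' :\ e) Ex p (fun G => (ends e :|: ends f \subset hits G B s w j)%:R)
    <= rho ^+ 2 * (2 * D * rho + r * rho ^+ 2).
  move=> h; have : rho ^+ 2 * (2 * D * rho + r * rho ^+ 2) <= rho ^+ 2 * 2^-1.
    by rewrite ler_wpM2l ?exprn_ge0.
  by lra.
apply: le_trans (_ : \sum_(f in S) ((f \in star S e.1)%:R * rho ^+ 3 +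
   (f \in star S e.2)%:R * rho ^+ 3 + rho ^+ 4) <= _).
  rewrite big_mkcond [leRHS]big_mkcond; apply: ler_sum => f _.
  have t0 : 0 <= (f \in star S e.1)%:R * rho ^+ 3 +
     (f \in star S e.2)%:R * rho ^+ 3 + rho ^+ 4.
    by rewrite !addr_ge0 ?mulr_ge0 ?exprn_ge0.
  case: (boolP (f \in S' :\ e)); last by case: ifP.
  rewrite !inE => /andP[fe fS']; have fS := subsetP S'S _ fS'.
  rewrite fS -gnp_probE prob_sub_hits /=.
  have le3 : rho ^+ #|ends e :|: ends f| <= rho ^+ 3.
    rewrite ler_wiXn2l //; exact: card_ends_pair (Slt eS) (Slt fS) fe.
  have g3 := exprn_ge0 3 r0; have g4 := exprn_ge0 4 r0.
  case: (boolP ((f.1 == e.1) || (f.2 == e.1))) => h1 /=.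
    by case: (_ || _) => /=; lra.
  case: (boolP ((f.1 == e.2) || (f.2 == e.2))) => h2 /=; first by lra.
  move: h1 h2; rewrite !negb_or => /andP[a1 a2] /andP[a3 a4].
  rewrite card_ends_disjoint //; first by lra.
  - exact: Slt.
  - exact: Slt.
  - by rewrite eq_sym.
  - by rewrite eq_sym.
  - by rewrite eq_sym.
  - by rewrite eq_sym.
rewrite !big_split /=.
have sE i : \sum_(f in S) (f \in star S i)%:R * rho ^+ 3 = #|star S i|%:R * rho ^+ 3.
  rewrite -big_distrl /=; congr (_ * _); rewrite -sum1_card natr_sum big_mkcond [RHS]big_mkcond /=; apply: eq_bigr => f _.
  by rewrite !inE; case: (f \in S) => //=; case: (_ || _).
have -> : \sum_(f in S) rho ^+ 4 = rho ^+ 4 * #|S|%:R by rewrite sumr_const mulr_natr.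
rewrite !sE.
have g3 := exprn_ge0 3 r0; have g4 := exprn_ge0 4 r0.
have := ler_wpM2r g3 (dS e.1); have := ler_wpM2r g3 (dS e.2).
have := ler_wpM2l g4 cS.
have -> : rho ^+ 2 * (2 * D * rho + r * rho ^+ 2) =
   D * rho ^+ 3 + D * rho ^+ 3 + rho ^+ 4 * r by ring.
by move=> *; rewrite !lerD.
Qed.

(** The events that [e] is the only missing pair seen exclude each other for different [e] in [A],
    so their probabilities add, and each of them removes a pair of [A]. The result is exponential in
    [#|A|], as if pairs survived independently. *)
Lemma prob_reduce S' A : S' \subset S -> A \subset S' ->
  gnp_prob p (fun G => A \subset reduce S' (hits G B s w j)) <=
  expR (- (#|A|%:R * (rho ^+ 2 / 2))).
Proof.
move=> S'S AS'; apply: le_trans (expR_ge1Dx _).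
apply: le_trans (_ : Ex p (fun G => 1 - \sum_(e in A)
   (inner S' (hits G B s w j) == [set e])%:R) <= _).
  rewrite gnp_probE; apply: ler_Ex => // G; set H := hits _ _ _ _ _.
  case: (pselect (exists2 e, e \in A & inner S' H == [set e])); last first.
    move=> ne; rewrite big1 ?subr0; first by case: (_ \subset _).
    by move=> e eA; case: eqP => // E; case: ne; exists e => //; apply/eqP.
  move=> [e eA /eqP E].
  have -> : (A \subset reduce S' H) = false.
    apply/negbTE/negP => /subsetP/(_ e eA).
    by rewrite /reduce E cards1 eqxx !inE eqxx.
  rewrite subr_ge0 (bigD1 e) //= E eqxx big1 ?addr0 // => f /andP[_ fe].
  case: eqP => // /setP/(_ e); rewrite !inE eqxx => /esym/eqP ef.
  by rewrite ef eqxx in fe.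
rewrite ExB Ex_cst lerD2l lerN2 Ex_sum mulr_natl -sumr_const.
apply: ler_sum => e eA; rewrite -gnp_probE; apply: prob_inner1 => //.
exact: (subsetP AS').
Qed.

End OneConnector.
End Process.

(** * One round of connectors *)

Section Stage.
Variables (R : realType) (n k : nat).
Implicit Types (p r D : R) (S A : {set 'I_k * 'I_k}) (B C : 'I_k -> {set 'I_n}).
Local Notation rho p s b := (hit_rate p (s * b)).

(** Induction on the connectors: for every value [T] of the current missing set, the next connector
    is independent of the past, and the bound for one connector is uniform in [T]. The exponent,
    linear in both [N] and [#|A|], is then read as a power [#|A|], the form that [random_set_tail]
    requires. *)
Lemma prob_process B (w : seq 'I_n) (s b : nat) p N S r D A :
  (forall i j, i != j -> [disjoint B i & B j]) -> (forall i, #|B i| = b) ->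
  uniq w -> (forall i, [disjoint B i & w]) -> 0 <= p <= 1 ->
  (N * s <= size w)%N -> (forall e, e \in S -> (e.1 < e.2)%N) -> #|S|%:R <= r ->
  (forall i, #|star S i|%:R <= D) ->
  2 * D * rho p s b + r * rho p s b ^+ 2 <= 2^-1 -> A \subset S ->
  gnp_prob p (fun G : graph n => A \subset process G B s w N S) <=
  expR (- (N%:R * (rho p s b ^+ 2 / 2))) ^+ #|A|.
Proof.
move=> dB cB uw dw hp Nw Slt cS dS small AS.
set th := expR (- (#|A|%:R * (rho p s b ^+ 2 / 2))).
have -> : expR (- (N%:R * (rho p s b ^+ 2 / 2))) ^+ #|A| = th ^+ N.
  by rewrite -!expRM_natl; congr expR; ring.
elim: N Nw => [|N IH] Nw.
  rewrite expr0 -[X in _ <= X](Ex_cst n p) gnp_probE; apply: ler_Ex => // G.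
  by case: (_ \subset _).
have Nw' : (N * s <= size w)%N by apply: leq_trans Nw; rewrite mulSn leq_addl.
rewrite exprS; apply: le_trans (ler_wpM2l (expR_ge0 _) (IH Nw')).
rewrite gnp_probE (@eq_Ex _ _ _ _ (fun G => \sum_(T : {set 'I_k * 'I_k} |
    (T \subset S) && (A \subset T)) (process G B s w N S == T)%:R *
    (A \subset reduce T (hits G B s w N))%:R)); last first.
  move=> G; rewrite processS; set P := process _ _ _ _ _ _.
  have PS : P \subset S by exact: process_sub.
  case: (boolP (A \subset P)) => AP.
    rewrite (bigD1 P) /= ?PS ?AP // eqxx mul1r big1 ?addr0 // => T /andP[_ /negbTE TP].
    by rewrite eq_sym TP mul0r.
  rewrite big1 => [|T /andP[_ AT]]; last first.
    by case: eqP => [PT|]; [rewrite PT AT in AP|rewrite mul0r].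
  by case: (boolP (A \subset reduce _ _)) => // h; rewrite (subset_trans h (reduce_sub _ _)) in AP.
rewrite Ex_sum.
apply: le_trans (_ : \sum_(T : {set 'I_k * 'I_k} | (T \subset S) && (A \subset T))
   Ex p (fun G => (process G B s w N S == T)%:R) * th <= _).
  apply: ler_sum => T /andP[TS AT].
  rewrite (@Ex_indep _ _ _ (fun G => (process G B s w N S == T)%:R)
     (fun G => (A \subset reduce T (hits G B s w N))%:R)
     (\bigcup_(j < N) blk (seg s w j) (\bigcup_i B i)) (blk (seg s w N) (\bigcup_i B i))).
  - rewrite ler_wpM2l ?Ex_ge0 // -gnp_probE.
    exact: (prob_reduce dB cB uw dw hp Nw (ltnSn N) Slt cS dS small TS AT).
  - by apply: (depends_on_comp (fun P => (P == T)%:R)); exact: process_depends.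
  - apply: (depends_on_comp (fun Q => (A \subset reduce T Q)%:R)).
    exact: hits_depends.
  apply/pred0P => e; apply/negbTE/negP => /= /andP[/bigcupP[j _ ej] eN].
  have jN : val j != N by rewrite neq_ltn ltn_ord.
  by have := disjointFr (@Z_disjoint _ _ B w s uw dw _ _ jN) ej; rewrite eN.
rewrite -big_distrl /= mulrC ler_wpM2l ?expR_ge0 // -Ex_sum gnp_probE.
apply: ler_Ex => // G; set P := process _ _ _ _ _ _.
case: (boolP (A \subset P)) => AP.
  have PS : P \subset S by exact: process_sub.
  rewrite (bigD1 P) /= ?PS ?AP // eqxx big1 ?addr0 // => T /andP[_ /negbTE TP].
  by rewrite eq_sym TP.
rewrite big1 // => T /andP[_ AT].
by case: eqP => [PT|//]; rewrite PT AT in AP.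
Qed.

(** All sets are existentially quantified, which makes the event increasing and lets the next round
    depend on numerical bounds only. *)
Definition good (G : graph n) (b m : nat) r D :=
  exists B C w S, [/\ @state n k G b B C w S, forall e, e \in S -> (e.1 < e.2)%N,
    (m <= size w)%N, #|S|%:R <= r & forall i, #|star S i|%:R <= D].

Lemma state_cores G b B C w S : @state n k G b B C w S ->
  [/\ forall i j, i != j -> [disjoint B i & B j], forall i, #|B i| = b, uniq w &
      forall i, [disjoint B i & w]].
Proof.
case=> BC cB _ dC [uw _ dw _]; split=> //.
  by move=> i j ij; apply: disjointWl (BC i) _; apply: disjointWr (BC j) _; exact: dC.
by move=> i; apply: disjointWl (BC i) (dw i).
Qed.

(** The surviving pairs, in [S] and in each star, satisfy a product bound with [th], so the tail
    bound applies to these [1 + k] random sets. *)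
Lemma good_stage G (b m s N : nat) p r D r' D' th : 0 <= p <= 1 ->
  good G b m r D -> (N * s <= m)%N ->
  2 * D * rho p s b + r * rho p s b ^+ 2 <= 2^-1 ->
  expR (- (N%:R * (rho p s b ^+ 2 / 2))) = th ->
  1 - (expR (- r' + 3 * th * r) + k%:R * expR (- D' + 3 * th * D)) <=
  gnp_prob p (fun H : graph n => `[< good (gunion G H) b (m - N * s) r' D' >]).
Proof.
move=> hp [B [C [w [S [st Slt mw cS dS]]]]] Nm small thE.
have [dB cB uw dw] := state_cores st.
have Nw := leq_trans Nm mw.
have PP A : A \subset S -> gnp_prob p (fun H : graph n => A \subset process H B s w N S)
    <= th ^+ #|A|.
  by move=> AS; rewrite -thE; apply: prob_process Nw Slt cS dS small AS.
have th0 : 0 <= th by rewrite -thE; exact: expR_ge0.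
rewrite lerBlDr -lerBlDl -gnp_probC.
pose E1 (H : graph n) := r' <= #|process H B s w N S|%:R.
pose E2 i (H : graph n) := D' <= #|star (process H B s w N S) i|%:R.
apply: le_trans (_ : gnp_prob p (fun H => E1 H || [exists i, xpredT i && E2 i H]) <= _).
  apply: gnp_prob_le => // H; apply: contraNT; rewrite negb_or negb_exists.
  move=> /andP[h1 /forallP h2]; apply/asboolP.
  have [C' st'] := state_process H s N st Slt.
  exists B, C', (drop (N * s) w), (process H B s w N S); split=> //.
  - by move=> e /(subsetP (process_sub _ _ _ _ _ _))/Slt.
  - by rewrite size_drop leq_sub2r.
  - by apply: ltW; rewrite ltNge.
  - by move=> i; apply: ltW; rewrite ltNge; exact: h2.
apply: le_trans (gnp_probU _ _ hp) _; apply: lerD.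
  apply: le_trans (random_set_tail (th := th) (Y := S) _ hp _ _ _) _ => //.
    by move=> H; exact: process_sub.
  by rewrite ler_expR lerD2l ler_wpM2l // mulr_ge0.
apply: le_trans (gnp_prob_exists _ _ hp) _.
rewrite -[k in leRHS]card_ord mulr_natl -sumr_const; apply: ler_sum => i _.
apply: le_trans (random_set_tail (th := th) (Y := star S i) _ hp _ _ _) _ => //.
- move=> H; apply/subsetP => e; rewrite !inE => /andP[eP ->].
  by rewrite (subsetP (process_sub _ _ _ _ _ _) _ eP).
- move=> A /subsetP AS; apply: le_trans (PP A _).
    apply: gnp_prob_le => // H /subsetP AH; apply/subsetP => e /AH.
    by rewrite inE => /andP[].
  by apply/subsetP => e /AS; rewrite inE => /andP[].
by rewrite ler_expR lerD2l ler_wpM2l // mulr_ge0.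
Qed.

Lemma good_minor G (b m s N : nat) p r D : 0 <= p <= 1 -> (0 < b)%N ->
  good G b m r D -> (N * s <= m)%N ->
  2 * D * rho p s b + r * rho p s b ^+ 2 <= 2^-1 ->
  1 - r * expR (- (N%:R * (rho p s b ^+ 2 / 2))) <=
  gnp_prob p (fun H : graph n => `[< has_K_minor (gunion G H) k >]).
Proof.
move=> hp b0 [B [C [w [S [st Slt mw cS dS]]]]] Nm small; set th := expR _.
have [dB cB uw dw] := state_cores st.
have Nw := leq_trans Nm mw.
rewrite lerBlDr -lerBlDl -gnp_probC.
apply: le_trans (_ : gnp_prob p (fun H =>
   [exists e, (e \in S) && ([set e] \subset process H B s w N S)]) <= _).
  apply: gnp_prob_le => // H; apply: contraNT; rewrite negb_exists => /forallP h.
  apply/asboolP; have [C' st'] := state_process H s N st Slt.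
  apply: (state_minor b0 st'); apply/setP => e; rewrite inE; apply/negbTE/negP => eP.
  by have := h e; rewrite sub1set eP (subsetP (process_sub _ _ _ _ _ _) _ eP).
apply: le_trans (gnp_prob_exists _ _ hp) _.
apply: le_trans (_ : \sum_(e in S) th <= _).
  apply: ler_sum => e eS; rewrite -[th]expr1 -(cards1 e).
  by apply: prob_process Nw Slt cS dS small _; rewrite // sub1set.
by rewrite sumr_const -[_ *+ _]mulr_natl ler_wpM2r ?expR_ge0.
Qed.

End Stage.

(** * The chain of sprinkling rounds *)

Section Base.
Variables (R : realType) (n k : nat).
Implicit Types (p r D : R).

Definition has_path (G : graph n) (m : nat) :=
  exists u, [/\ uniq u, sorted (adj G) u & (n <= size u + 2 * m)%N].

Lemma prob_long_path p (m : nat) : 0 <= p <= 1 ->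
  1 - 4 ^+ n * (1 - p) ^+ (m * m) <=
  gnp_prob p (fun G : graph n => `[< has_path G m >]).
Proof.
move=> hp; rewrite lerBlDr -lerBlDl -gnp_probC.
pose good (XY : {set 'I_n} * {set 'I_n}) :=
  [&& [disjoint XY.1 & XY.2], #|XY.1| == m & #|XY.2| == m].
apply: le_trans (_ : gnp_prob p (fun G =>
   [exists XY, good XY && ~~ hit G XY.1 XY.2]) <= _).
  apply: gnp_prob_le => // G; apply: contraNT; rewrite negb_exists => /forallP h.
  apply/asboolP/long_path => X Y dXY cX cY; have := h (X, Y).
  by rewrite /good dXY cX cY !eqxx /= negbK.
apply: le_trans (gnp_prob_exists _ _ hp) _.
apply: le_trans (_ : \sum_(XY : {set 'I_n} * {set 'I_n}) (1 - p) ^+ (m * m) <= _).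
  rewrite big_mkcond; apply: ler_sum => -[X Y] _; case: ifP => [|_].
    by case/and3P=> /= dXY /eqP <- /eqP cY; rewrite prob_no_hit // cY.
  by rewrite exprn_ge0 // subr_ge0; case/andP: hp.
rewrite -(pair_big xpredT xpredT (fun _ _ : {set 'I_n} => (1 - p) ^+ (m * m))) /=.
have c2 (c : R) : \sum_(X : {set 'I_n}) c = 2 ^+ n * c.
  have /= := sum_subset_pow [set: 'I_n] (1 : R); rewrite cardsT card_ord => h.
  have -> : 2 = 1 + 1 :> R by ring.
  rewrite -h big_distrl big_mkcond [RHS]big_mkcond /=; apply: eq_bigr => X _.
  by rewrite finset.subsetT expr1n mul1r.
rewrite !c2 mulrA -exprMn (_ : 2 * 2 = 4) //; ring.
Qed.

Lemma card_star_le (S : {set 'I_k * 'I_k}) i : (#|star S i| <= 2 * k)%N.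
Proof.
have sub : star S i \subset finset.setX [set i] [set: 'I_k] :|: finset.setX [set: 'I_k] [set i].
  apply/subsetP => -[x y]; rewrite !inE /= => /andP[_ /orP[] ->]; rewrite ?orbT //.
apply: leq_trans (subset_leq_card sub) _.
apply: leq_trans (leq_card_setU _ _).1 _.
by rewrite !cardsX !cards1 !cardsT !card_ord; lia.
Qed.

(** Consecutive blocks of the path are both cores and initial branch sets; the remainder is the
    pool. Different pairs of blocks involve disjoint sets of edges, so they are nonadjacent
    independently with probability [q], and the tail bound applies to all pairs and to the stars, of
    at most [2 * k] pairs each. *)
Lemma good_base (G : graph n) (u : seq 'I_n) p q (b : nat) r D :
  0 <= p <= 1 -> uniq u -> sorted (adj G) u -> (k * b <= size u)%N ->
  (1 - p) ^+ (b * b) = q ->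
  1 - (expR (- r + 3 * q * (k * k)%:R) + k%:R * expR (- D + 3 * q * (2 * k)%:R)) <=
  gnp_prob p (fun H : graph n => `[< @good R n k (gunion G H) b (size u - k * b) r D >]).
Proof.
move=> hp uu su kb qE.
have q0 : 0 <= q by rewrite -qE exprn_ge0 // subr_ge0; case/andP: hp.
pose B (i : 'I_k) := seg b u i.
pose Y := [set e : 'I_k * 'I_k | (e.1 < e.2)%N].
pose S (H : graph n) := [set e in Y | ~~ hit H (B e.1) (B e.2)].
have dB i j : i != j -> [disjoint B i & B j].
  by move=> ij; apply: seg_disjoint.
have cB i : #|B i| = b by exact: (card_seg uu kb (ltn_ord i)).
have stH H : state (gunion G H) b B B (drop (k * b) u) (S H).
  split=> //.
  - move=> i; apply: (gsub_connected (@gsubUl n G H)); apply: induced_connected_seq.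
    by apply/take_sorted/drop_sorted.
  - split; first exact: drop_uniq.
    + by apply: (gsub_sorted (@gsubUl n G H)); apply: drop_sorted.
    + move=> i; apply/pred0P => x; apply/negbTE/negP => /=; rewrite inE.
      case/andP => xi xd.
      have /andP[_ h1] := index_seg uu xi.
      have xd' : x \in take (size u) (drop (k * b) u) by rewrite take_oversize // size_drop leq_subr.
      have /andP[h2 _] := index_seg uu xd'.
      have := leq_mul (ltn_ord i) (leqnn b); rewrite mulSn => h3.
      by have := leq_trans (leq_trans h1 _) h2; rewrite addnC ltnn => /(_ h3).
  move=> i j ij; rewrite !inE /= ij /= negbK => h.
  exact: gsub_hit (@gsubUr n G H) h.
have PP (A : {set 'I_k * 'I_k}) : A \subset Y -> gnp_prob p (fun H : graph n => A \subset S H) <= q ^+ #|A|.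
  move=> /subsetP AY; rewrite le_eqVlt; apply/orP; left; apply/eqP.
  transitivity (gnp_prob p (fun H : graph n =>
     [forall (e | e \in A), ~~ hit H (B e.1) (B e.2)])).
    rewrite !gnp_probE; apply: eq_Ex => H; congr (nat_of_bool _)%:R.
    apply/subsetP/forall_inP => h e eA; first by have := h e eA; rewrite inE => /andP[].
    by rewrite inE AY //= h.
  have Ylt e : e \in A -> (e.1 < e.2)%N by move=> /AY; rewrite inE.
  have Yne e : e \in A -> e.1 != e.2.
    by move=> /Ylt; apply: contraTneq => ->; rewrite ltnn.
  rewrite (@prob_all_indep _ _ _ _ (mem A) (fun e H => ~~ hit H (B e.1) (B e.2))
    (fun e => blk (B e.1) (B e.2))).
  - rewrite (eq_bigr (fun=> q)) ?prodr_const // => e eA.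
    by rewrite prob_no_hit ?cB // dB // Yne.
  - by move=> e _; apply: (depends_on_comp negb); exact: hit_depends.
  move=> e f eA fA ef; apply/pred0P => -[x y] /=; apply/negbTE/negP.
  have same i j z : z \in B i -> z \in B j -> i = j.
    by move=> zi zj; apply/eqP/negPn/negP => /dB d; rewrite (disjointFr d zi) in zj.
  rewrite !(in_setU, in_setX).
  case/andP => /orP[] /andP[h1 h2] /orP[] /andP[h3 h4].
  - case/eqP: ef; rewrite [e]surjective_pairing [f]surjective_pairing.
    by rewrite (same _ _ _ h1 h3) (same _ _ _ h2 h4).
  - have := Ylt _ eA; have := Ylt _ fA.
    by rewrite (same _ _ _ h1 h3) (same _ _ _ h2 h4); case: ltngtP.
  - have := Ylt _ eA; have := Ylt _ fA.
    by rewrite (same _ _ _ h1 h3) (same _ _ _ h2 h4); case: ltngtP.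
  case/eqP: ef; rewrite [e]surjective_pairing [f]surjective_pairing.
  by rewrite (same _ _ _ h1 h3) (same _ _ _ h2 h4).
rewrite lerBlDr -lerBlDl -gnp_probC.
pose E1 (H : graph n) := r <= #|S H|%:R.
pose E2 i (H : graph n) := D <= #|star (S H) i|%:R.
apply: le_trans (_ : gnp_prob p (fun H => E1 H || [exists i, xpredT i && E2 i H]) <= _).
  apply: gnp_prob_le => // H; apply: contraNT; rewrite negb_or negb_exists.
  move=> /andP[h1 /forallP h2]; apply/asboolP.
  exists B, B, (drop (k * b) u), (S H); split=> //.
  - by move=> e; rewrite !inE => /andP[].
  - by rewrite size_drop.
  - by apply: ltW; rewrite ltNge.
  - by move=> i; apply: ltW; rewrite ltNge; exact: h2.
apply: le_trans (gnp_probU _ _ hp) _; apply: lerD.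
  apply: le_trans (random_set_tail (th := q) (Y := Y) _ hp _ _ _) _ => //.
    by move=> H; apply/subsetP => e; rewrite inE => /andP[].
  rewrite ler_expR lerD2l ler_wpM2l ?mulr_ge0 // ler_nat.
  by apply: leq_trans (max_card _) _; rewrite card_prod card_ord.
apply: le_trans (gnp_prob_exists _ _ hp) _.
apply: le_trans (_ : \sum_(i < k) expR (- D + 3 * q * (2 * k)%:R) <= _); last first.
  by rewrite sumr_const card_ord -[leLHS]mulr_natl.
apply: ler_sum => i _.
apply: le_trans (random_set_tail (th := q) (Y := star Y i) _ hp _ _ _) _ => //.
- by move=> H; apply/subsetP => e; rewrite !inE => /andP[/andP[-> _] ->].
- move=> A /subsetP AS; apply: le_trans (PP A _).
    apply: gnp_prob_le => // H /subsetP AH; apply/subsetP => e /AH.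
    by rewrite inE => /andP[].
  by apply/subsetP => e /AS; rewrite inE => /andP[].
by rewrite ler_expR lerD2l ler_wpM2l ?mulr_ge0 // ler_nat card_star_le.
Qed.

Lemma good_increasing (b m : nat) r D :
  increasing (fun G : graph n => `[< @good R n k G b m r D >]).
Proof.
move=> G H /asboolP[B [C [w [S [st ? ? ? ?]]]]]; apply/asboolP.
by exists B, C, w, S; split=> //; apply: state_gsub st; exact: gsubUl.
Qed.

Lemma has_K_minor_increasing : increasing (fun G : graph n => `[< has_K_minor G k >]).
Proof.
move=> G H /asboolP[B [B0 Bc Bd Ba]]; apply/asboolP; exists B; split=> //.
  by move=> h; apply: gsub_connected (Bc h); exact: gsubUl.
move=> h h' hh; have [x [y [xh yh a]]] := Ba h h' hh.
by exists x, y; split=> //; apply: gsub_adj a; exact: gsubUl.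
Qed.

End Base.

(** * Elementary estimates for hitting probabilities *)

Lemma bernoulli_ineq (R : realType) (y : R) m : 0 <= y <= 1 -> 1 - m%:R * y <= (1 - y) ^+ m.
Proof.
move=> hy; elim: m => [|m IH]; first by rewrite expr0; lra.
rewrite exprS -natr1.
have : (1 - y) * (1 - m%:R * y) <= (1 - y) * (1 - y) ^+ m by rewrite ler_wpM2l //; lra.
have : 0 <= m%:R * (y * y) :> R by rewrite mulr_ge0 // mulr_ge0; lra.
by lra.
Qed.

(** Above by Bernoulli's inequality, below by [(1 - x / m) ^ m <= exp(- x) <= 1 - x / 2] on the unit
    interval. *)
Lemma hit_rate_bounds (R : realType) (x : R) m : (0 < m)%N -> 0 <= x <= 1 ->
  x / 2 <= hit_rate (x / m%:R) m <= x.
Proof.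
move=> m0 hx; rewrite /hit_rate.
have mR : 0 < m%:R :> R by rewrite ltr0n.
have m1 : 1 <= m%:R :> R by rewrite ler1n.
have y01 : 0 <= x / m%:R <= 1.
  by apply/andP; split; [apply: divr_ge0|rewrite ler_pdivrMr //]; lra.
apply/andP; split; last first.
  have := bernoulli_ineq m y01; rewrite mulrCA mulfV ?gt_eqF //; lra.
have : (1 - x / m%:R) ^+ m <= expR (- x).
  have -> : - x = m%:R * (- (x / m%:R)) by field; rewrite gt_eqF.
  rewrite expRM_natl lerXn2r ?nnegrE ?expR_ge0 //; first lra.
  by apply: le_trans (expR_ge1Dx _); lra.
have : expR (- x) <= 1 - x / 2.
  rewrite expRN -[leRHS]invrK lef_pV2 ?posrE ?expR_gt0 ?invr_gt0; try lra.
  apply: le_trans (expR_ge1Dx x).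
  rewrite -div1r ler_pdivrMr; last by lra.
  have : 0 <= x * (1 - x) by rewrite mulr_ge0; lra.
  by lra.
by lra.
Qed.

Lemma expR_le_half (R : realType) m : expR (- m%:R) <= 2 ^- m :> R.
Proof.
rewrite -[m%:R]mulr1 -mulrN expRM_natl -exprVn lerXn2r ?nnegrE ?expR_ge0 ?invr_ge0 //.
rewrite expRN lef_pV2 ?posrE ?expR_gt0 //.
by apply: le_trans (expR_ge1Dx _); lra.
Qed.

Lemma good_weaken (R : realType) (n k b m m' : nat) (r D : R) (G : graph n) :
  (m' <= m)%N -> good k G b m r D -> good k G b m' r D.
Proof.
move=> mm [B [C [w [S [st ? mw ? ?]]]]].
by exists B, C, w, S; split=> //; exact: leq_trans mm mw.
Qed.

(** * Parameters and success probability of the chain of rounds *)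

Section Chain.
Variables (R : realType) (n k b T M m : nat) (p p1 p2 x0 : R).
Hypotheses (b0 : (0 < b)%N) (M0 : (0 < M)%N) (x0E : x0 = Num.sqrt (128 / M%:R))
  (MT : (128 * 16 ^ T <= M)%N) (p10 : 0 <= p1) (p20 : 0 <= p2)
  (pp : p1 + p2 + 2 * x0 / b%:R <= p) (ple1 : p <= 1)
  (budget : (k * b + 3 * M + 2 * m <= n)%N).

(* Round [t] uses [connectors t] connectors of length [8 ^ t] and edge probability
   [stage_prob t]; a connector then sees a given branch set with probability
   between [rate t / 2] and [rate t]. *)
Definition rate (t : nat) := 4 ^+ t * x0.
(** This and [degree_left] are chosen so that, for a hit probability at most [rate t], the pair term
    and the degree term of the Bonferroni condition are at most 1/4 each. *)
Definition pairs_left (t : nat) := 1 / (4 * rate t ^+ 2).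
Definition degree_left (t : nat) := 1 / (8 * rate t).
Definition connectors (t : nat) := (M %/ 16 ^ t)%N.
Definition stage_prob (t : nat) := rate t / (8 ^ t * b)%:R.
Fixpoint pool (t : nat) : nat :=
  if t is t'.+1 then (pool t' - connectors t' * 8 ^ t')%N else (3 * M)%N.
Definition prob_before (t : nat) := p1 + p2 + \sum_(i < t) stage_prob i.
(** The last round has the largest rate, hence the weakest bound, which then serves for every
    round. *)
Definition stage_failure := (1 + k%:R) * expR (- (1 / (128 * rate T))).
Definition base_failure :=
  4 ^+ n * (1 - p1) ^+ (m * m) +
  (expR (- pairs_left 0 + 3 * (1 - p2) ^+ (b * b) * (k * k)%:R) +
   k%:R * expR (- degree_left 0 + 3 * (1 - p2) ^+ (b * b) * (2 * k)%:R)).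

Lemma x0_gt0 : 0 < x0.
Proof. by rewrite x0E sqrtr_gt0 divr_gt0 // ltr0n. Qed.

Lemma rate_gt0 t : 0 < rate t.
Proof. by rewrite /rate mulr_gt0 ?exprn_gt0 ?x0_gt0. Qed.

Lemma rate_sq t : rate t ^+ 2 = (16 ^ t)%:R * 128 / M%:R.
Proof.
rewrite /rate exprMn x0E sqr_sqrtr ?divr_ge0 // mulrA; congr (_ * _ * _).
by rewrite natrX -exprM mulnC exprM; congr (_ ^+ _); ring.
Qed.

Lemma rate_mono i t : (i <= t)%N -> rate i <= rate t.
Proof.
move=> it; rewrite /rate ler_pM2r ?x0_gt0 // ler_weXn2l // ?ler1n //.
Qed.

Lemma rate_le1 t : (t <= T)%N -> rate t <= 1.
Proof.
move=> tT; apply: le_trans (rate_mono tT) _.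
have y0 := ltW (rate_gt0 T).
rewrite -(@ler_pXn2r _ 2) ?nnegrE // expr1n rate_sq.
have MR : 0 < M%:R :> R by rewrite ltr0n.
by rewrite ler_pdivrMr // mul1r -natrM ler_nat mulnC.
Qed.

(** The invariant [pool t >= M + 2 * M / 2 ^ t], cleared of denominators. Round [t] spends at most
    [M / 2 ^ t] vertices, so at least [M] are left for the final repair. *)
Lemma pool_ge t : ((2 ^ t + 2) * M <= pool t * 2 ^ t)%N.
Proof.
elim: t => [|t IH] /=; first by rewrite expn0 muln1.
have h : (connectors t * 8 ^ t * 2 ^ t <= M)%N.
  by rewrite -mulnA -expnMn /connectors leq_divM.
rewrite expnS mulnCA mulnBl.
have := IH; rewrite !mulnDl !mulnBr => IH'; lia.
Qed.

Lemma pool_stage t : (connectors t * 8 ^ t <= pool t)%N.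
Proof.
have h : (connectors t * 8 ^ t * 2 ^ t <= M)%N.
  by rewrite -mulnA -expnMn /connectors leq_divM.
rewrite -(@leq_pmul2r (2 ^ t)) ?expn_gt0 //.
by apply: leq_trans (leq_trans h _) (pool_ge t); rewrite mulnDl; lia.
Qed.

Lemma pool_final : (M %/ 8 ^ T * 8 ^ T <= pool T)%N.
Proof.
apply: leq_trans (leq_divM _ _) _.
rewrite -(@leq_pmul2r (2 ^ T)) ?expn_gt0 //.
by apply: leq_trans (pool_ge T); rewrite mulnC mulnDl leq_addr.
Qed.

Lemma stage_prob_ge0 t : 0 <= stage_prob t.
Proof. by rewrite /stage_prob divr_ge0 // ltW ?rate_gt0. Qed.

(** The summands are [x0 / (b * 2 ^ i)], a geometric series below [2 * x0 / b]. *)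
Lemma prob_before_le t : prob_before t <= p.
Proof.
apply: le_trans pp; rewrite /prob_before lerD2l.
have bR : 0 < b%:R :> R by rewrite ltr0n.
have -> : \sum_(i < t) stage_prob i = 2 * x0 / b%:R - 2 * x0 / b%:R * 2 ^- t.
  elim: t => [|t IH]; first by rewrite big_ord0 expr0 invr1; ring.
  rewrite big_ord_recr /= IH /stage_prob /rate natrM natrX exprSr.
  have -> : 8 ^+ t = 4 ^+ t * 2 ^+ t :> R by rewrite -exprMn; congr (_ ^+ _); ring.
  have h2 : 2 ^+ t != 0 :> R by rewrite expf_neq0 // pnatr_eq0.
  have h4 : 4 ^+ t != 0 :> R by rewrite expf_neq0 // pnatr_eq0.
  by field; rewrite h2 h4 gt_eqF.
rewrite gerBl mulr_ge0 // ?invr_ge0 ?exprn_ge0 // divr_ge0 ?ltW // mulr_gt0 //.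
exact: x0_gt0.
Qed.

Lemma stage_prob_bounds t : 0 <= stage_prob t <= 1.
Proof.
rewrite stage_prob_ge0 /=; apply: le_trans ple1; apply: le_trans (prob_before_le t.+1).
rewrite /prob_before big_ord_recr /= addrA lerDr !addr_ge0 //.
by apply: sumr_ge0 => j _; exact: stage_prob_ge0.
Qed.

Local Notation rho t := (hit_rate (stage_prob t) (8 ^ t * b)).

Lemma rho_rate t : (t <= T)%N -> rate t / 2 <= rho t <= rate t.
Proof.
move=> tT; apply: hit_rate_bounds; first by rewrite muln_gt0 expn_gt0.
by rewrite ltW ?rate_gt0 //= rate_le1.
Qed.

Lemma stage_small t : (t <= T)%N ->
  2 * degree_left t * rho t + pairs_left t * rho t ^+ 2 <= 2^-1.
Proof.
move=> /rho_rate/andP[lo hi]; have y0 := rate_gt0 t.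
rewrite /degree_left /pairs_left; move: (rate t) (rho t) lo hi y0 => y z lo hi y0.
have -> : 2 * (1 / (8 * y)) * z + 1 / (4 * y ^+ 2) * z ^+ 2 =
   (z / y) / 4 + (z / y) ^+ 2 / 4 by field; rewrite gt_eqF.
have z0 : 0 <= z / y by apply: divr_ge0; lra.
have z1 : z / y <= 1 by rewrite ler_pdivrMr ?mul1r.
have : (z / y) ^+ 2 <= 1 by rewrite exprn_ile1.
by lra.
Qed.

(** As [rate t ^+ 2 = 128 * 16 ^ t / M] and [rho] is at least half of [rate], the exponent is at
    least [16 * c * (N * q / M)]; rounding the number of connectors down loses at most a factor 2.
    Ordinary rounds have [c = 1]; the final one uses [M %/ 8 ^ T] connectors and has [c = 2 ^ T]. *)
Lemma decay_exponent (N q : nat) (c : R) t : (t <= T)%N -> (M <= N * 2 * q)%N ->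
  (0 < q)%N -> (16 ^ t)%:R = c * q%:R ->
  expR (- (N%:R * (rho t ^+ 2 / 2))) <= expR (- (8 * c)).
Proof.
move=> tT MN q0 cq; rewrite ler_expR lerN2.
have MR : 0 < M%:R :> R by rewrite ltr0n.
have qR : 0 < q%:R :> R by rewrite ltr0n.
have c0 : 0 <= c by rewrite -(pmulr_lge0 _ qR) -cq.
have /andP[lo _] := rho_rate tT; have y0 := rate_gt0 t.
have sq : rate t ^+ 2 / 4 <= rho t ^+ 2.
  have -> : rate t ^+ 2 / 4 = (rate t / 2) ^+ 2 by field.
  by rewrite lerXn2r ?nnegrE //; lra.
have : N%:R * (rate t ^+ 2 / 8) <= N%:R * (rho t ^+ 2 / 2).
  by rewrite ler_wpM2l //; lra.
apply: le_trans; rewrite rate_sq cq.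
have -> : N%:R * (c * q%:R * 128 / M%:R / 8) = 8 * c * ((N%:R * 2 * q%:R) / M%:R).
  by field; rewrite gt_eqF.
rewrite -[leLHS]mulr1 ler_wpM2l ?mulr_ge0 // ler_pdivlMr // mul1r.
by rewrite -[2]/(2%:R) -!natrM ler_nat.
Qed.

Lemma connectors_decay t : (t <= T)%N ->
  expR (- ((connectors t)%:R * (rho t ^+ 2 / 2))) <= 256^-1.
Proof.
move=> tT; apply: le_trans (@decay_exponent (connectors t) (16 ^ t) 1 t tT _ _ _) _.
- rewrite /connectors; have q0 : (0 < 16 ^ t)%N by rewrite expn_gt0.
  have : (0 < M %/ 16 ^ t)%N.
    rewrite divn_gt0 //; apply: leq_trans MT.
    by rewrite (@leq_trans (16 ^ T)) ?leq_pexp2l // leq_pmull.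
  have := ltn_ceil M q0; move: (M %/ 16 ^ t)%N (16 ^ t)%N => N q; nia.
- by rewrite expn_gt0.
- by rewrite mul1r.
have := expR_le_half R 8; rewrite mulr1; move/le_trans; apply.
by rewrite le_eqVlt; apply/orP; left; apply/eqP; congr (_^-1); ring.
Qed.

Lemma final_decay :
  expR (- ((M %/ 8 ^ T)%:R * (rho T ^+ 2 / 2))) <= expR (- (8 * (2 ^ T)%:R)).
Proof.
apply: (@decay_exponent (M %/ 8 ^ T) (8 ^ T)) => //.
- have q0 : (0 < 8 ^ T)%N by rewrite expn_gt0.
  have : (0 < M %/ 8 ^ T)%N.
    rewrite divn_gt0 //; apply: leq_trans MT.
    by rewrite (_ : 16 = 8 * 2)%N // expnMn mulnCA leq_pmulr // muln_gt0 expn_gt0.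
  have := ltn_ceil M q0; move: (M %/ 8 ^ T)%N (8 ^ T)%N => N q; nia.
- by rewrite expn_gt0.
by rewrite -natrM -expnMn.
Qed.

Lemma stage_failure_ge0 : 0 <= stage_failure.
Proof. by rewrite /stage_failure mulr_ge0 ?expR_ge0 // addr_ge0. Qed.

Lemma rateS t : rate t.+1 = 4 * rate t.
Proof. by rewrite /rate exprS mulrA. Qed.

Lemma pairs_leftS t : pairs_left t.+1 = pairs_left t / 16.
Proof. by rewrite /pairs_left rateS; field; rewrite gt_eqF ?rate_gt0. Qed.

Lemma degree_leftS t : degree_left t.+1 = degree_left t / 4.
Proof. by rewrite /degree_left rateS; field; rewrite gt_eqF ?rate_gt0. Qed.

Lemma pairs_left_ge0 t : 0 <= pairs_left t.
Proof.
apply: divr_ge0 => //; apply: mulr_ge0 => //; apply: exprn_ge0.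
exact: ltW (rate_gt0 t).
Qed.

Lemma degree_left_ge0 t : 0 <= degree_left t.
Proof. by apply: divr_ge0 => //; apply: mulr_ge0 => //; exact: ltW (rate_gt0 t). Qed.

Lemma base_good :
  1 - base_failure <= gnp_prob (p1 + p2)
    (fun G : graph n => `[< good k G b (pool 0) (pairs_left 0) (degree_left 0) >]).
Proof.
have h := prob_before_le 0; rewrite /prob_before big_ord0 addr0 in h.
have [h1 h2 h3] : [/\ 0 <= p1 <= 1, 0 <= p2 <= 1 & p1 + p2 <= 1].
  have := (p10, p20, ple1) => -[[? ?] ?].
  by split; lra.
apply: (sprinkle (Q := fun G => `[< has_path G m >]) p10 p20 (lexx _) h3).
- by rewrite addr_ge0 // ?mulr_ge0 ?expR_ge0.
- exact: good_increasing.
- exact: prob_long_path.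
move=> G /asboolP[u [uu su nu]].
have := leq_trans budget nu; rewrite leq_add2r => kM.
have kb := leq_trans (leq_addr _ _) kM.
apply: le_trans (good_base (pairs_left 0) (degree_left 0) h2 uu su kb (erefl _)) _.
apply: gnp_prob_le => // H /asboolP g; apply/asboolP; apply: good_weaken g.
by rewrite /= leq_subRL.
Qed.

(** With [th <= 1/256], the terms [3 * th * r] and [3 * th * D] of the tail bound stay below the
    next thresholds [r / 16] and [D / 4]. Both exponents are then at least [1 / (128 * rate t)]; for
    the pairs this uses [rate t <= 1]. *)
Lemma chain_good t : (t <= T)%N ->
  1 - (base_failure + t%:R * stage_failure) <= gnp_prob (prob_before t)
    (fun G : graph n => `[< good k G b (pool t) (pairs_left t) (degree_left t) >]).
Proof.
elim: t => [|t IH] tT.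
  by rewrite mul0r addr0 /prob_before big_ord0 addr0; exact: base_good.
have -> : base_failure + t.+1%:R * stage_failure =
  (base_failure + t%:R * stage_failure) + stage_failure by rewrite -natr1; ring.
have bt : 0 <= prob_before t.
  by rewrite !addr_ge0 //; apply: sumr_ge0 => i _; exact: stage_prob_ge0.
apply: (sprinkle bt (stage_prob_ge0 t) _ _ stage_failure_ge0 _ (IH (ltnW tT))).
- by rewrite /prob_before big_ord_recr /= !addrA.
- exact: le_trans (prob_before_le _) ple1.
- exact: good_increasing.
move=> G /asboolP g.
have small := stage_small (ltnW tT).
have := good_stage (pairs_left t.+1) (degree_left t.+1) (stage_prob_bounds t) g
  (pool_stage t) small (erefl _).
apply: le_trans; rewrite lerD2l lerN2.
have := connectors_decay (ltnW tT); have := expR_ge0 (- ((connectors t)%:R * (rho t ^+ 2 / 2))).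
move: (expR (- (_ * (_ / 2)))) => th th0 th1.
have y0 := rate_gt0 t; have y1 := rate_le1 (ltnW tT); have yT := rate_mono (ltnW tT).
have yT0 := rate_gt0 T.
have E (z : R) : 1 / (128 * rate t) <= - z ->
    expR z <= expR (- (1 / (128 * rate T))).
  move=> h; rewrite ler_expR lerNr; apply: le_trans h.
  move: (rate t) (rate T) y0 yT0 yT => y Y hy hY yY.
  by rewrite !div1r lef_pV2 ?posrE ?mulr_gt0 // ler_pM2l.
rewrite /stage_failure [leRHS]mulrDl [X in _ <= X + _]mul1r; apply: lerD; last first.
  rewrite ler_wpM2l //; apply: E; rewrite degree_leftS.
  have : 3 * th * degree_left t <= 3 * 256^-1 * degree_left t.
    by rewrite ler_wpM2r ?degree_left_ge0 //; lra.
  have -> : 1 / (128 * rate t) = degree_left t / 16.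
    by rewrite /degree_left; field; rewrite gt_eqF.
  have := degree_left_ge0 t.
  by lra.
apply: E; rewrite pairs_leftS.
have r0 := pairs_left_ge0 t.
have : 3 * th * pairs_left t <= 3 * 256^-1 * pairs_left t.
  by rewrite ler_wpM2r //; lra.
have : 1 / (128 * rate t) <= pairs_left t / 32.
  have -> : pairs_left t / 32 = 1 / (128 * rate t ^+ 2).
    by rewrite /pairs_left; field; rewrite gt_eqF.
  move: (rate t) (rate T) y0 y1 yT0 yT => y Y hy hy1 hY yY.
  rewrite !div1r lef_pV2 ?posrE ?mulr_gt0 ?exprn_gt0 // ler_pM2l //.
  by rewrite expr2 ler_piMr // ltW.
by lra.
Qed.

Lemma prob_minor_ge :
  1 - (base_failure + T%:R * stage_failure + pairs_left T * expR (- (8 * (2 ^ T)%:R))) <=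
  gnp_prob p (fun G : graph n => `[< has_K_minor G k >]).
Proof.
have bt : 0 <= prob_before T.
  by rewrite !addr_ge0 //; apply: sumr_ge0 => i _; exact: stage_prob_ge0.
have r0 := pairs_left_ge0 T.
have e0 : 0 <= pairs_left T * expR (- (8 * (2 ^ T)%:R)) by rewrite mulr_ge0 ?expR_ge0.
have ps : prob_before T + stage_prob T <= p.
  by apply: le_trans (prob_before_le T.+1); rewrite /prob_before big_ord_recr /= !addrA.
apply: (sprinkle bt (stage_prob_ge0 T) ps ple1 e0 _ (chain_good (leqnn T))).
  exact: has_K_minor_increasing.
move=> G /asboolP g.
apply: le_trans (good_minor (stage_prob_bounds T) b0 g pool_final (stage_small (leqnn T))).
by rewrite lerD2l lerN2 ler_wpM2l // final_decay.
Qed.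

End Chain.

(** * Explicit bounds *)

Section Ccl.
Variables (n : nat).
Implicit Types (G : graph n).

Lemma has_K_minor_le G k k' : (k' <= k)%N -> has_K_minor G k -> has_K_minor G k'.
Proof.
move=> kk [B [B0 Bc Bd Ba]]; exists (fun i => B (widen_ord kk i)).
have inj (i j : 'I_k') : i != j -> widen_ord kk i != widen_ord kk j.
  by apply: contra => /eqP/(congr1 val)/= /val_inj ->.
by split=> // i j /inj; [exact: Bd|exact: Ba].
Qed.

Lemma has_K_minor_card G k : has_K_minor G k -> (k <= n)%N.
Proof.
case=> B [B0 _ Bd _].
have /choice[f fB] : forall i, exists v, v \in B i by move=> i; apply/set0Pn.
have inj : injective f.
  move=> i j fij; apply/eqP/negPn/negP => /Bd d.
  by have := disjointFr d (fB i); rewrite fij fB.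
by have := leq_card f inj; rewrite !card_ord.
Qed.

Lemma leq_ccl G k : has_K_minor G k -> (k <= ccl G)%N.
Proof.
move=> h; have kn : (k < n.+1)%N by rewrite ltnS; apply: has_K_minor_card h.
rewrite /ccl; apply: (leq_trans (_ : k <= val (Ordinal kn))%N) => //.
by apply: (@leq_bigmax_cond _ (fun i : 'I_n.+1 => `[< has_K_minor G i >]) val); apply/asboolP.
Qed.

Lemma has_K_minor_ccl G : has_K_minor G (ccl G).
Proof.
(* [K_0] is a minor through the empty family, so the maximum is attained. *)
rewrite /ccl; have h0 : has_K_minor G 0 by exists (fun=> finset.set0); split=> -[].
have c0 : (0 < #|[pred k : 'I_n.+1 | `[< has_K_minor G k >]]|)%N.
  by apply/card_gt0P; exists ord0; rewrite inE; apply/asboolP.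
by have [i /asboolP hi ->] := eq_bigmax_cond val c0.
Qed.

End Ccl.

(** * Upper tail of [ccl] *)

Section UpperExplicit.
Variables (R : realType).

(** Let [d = n * p]. With [mu = p * (1 + e / 4)] and [k * (k - 1) >= (1 + e) * s ^ 2], the inner
    exponent [mu * n ^ 2 / (k * (k - 1))] is at most [(1 - e / 4) * L]. The pairs of trees therefore
    contribute an exponent at least [n * d ^ (e / 4) / (2 * L) >= 3 * n * L], against
    [(2 + 2 * d) ^ n <= exp(2 * n * L)] for the forests. *)
Lemma prob_ccl_gt (n : nat) (p e : R) (s := Num.sqrt (n%:R ^+ 2 * p / ln (n%:R * p))) :
  0 < e <= 2^-1 -> 0 < p -> p <= e / 8 -> 2 ^+ 8 <= ln (n%:R * p) * e ^+ 2 ->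
  1 <= n%:R * e ^+ 2 ->
  gnp_prob p (fun G : graph n => (1 + e) * s < (ccl G)%:R) <= expR (- n%:R).
Proof.
move=> /andP[e0 e1] p0 pe; rewrite {}/s; set L := ln _; set s := Num.sqrt _ => hL hn.
have e20 : 0 < e ^+ 2 by rewrite exprn_gt0.
have e21 : e ^+ 2 <= 1 by rewrite exprn_ile1 //; lra.
have L0 : 0 < L by rewrite -(pmulr_lgt0 _ e20); apply: lt_le_trans hL; rewrite exprn_gt0.
have L1 : 2 ^+ 8 <= L.
  by apply: le_trans hL _; rewrite ler_piMr // ltW.
have N0 : 0 < n%:R :> R.
  by rewrite -(pmulr_lgt0 _ e20); apply: lt_le_trans hn.
have d0 : 0 < n%:R * p by rewrite mulr_gt0.
have dE : expR L = n%:R * p by rewrite lnK.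
have s2 : s ^+ 2 = n%:R * (n%:R * p) / L.
  by rewrite sqr_sqrtr ?divr_ge0 ?mulr_ge0 ?(ltW L0) ?(ltW p0) // expr2 mulrA.
have dL : L <= n%:R * p by rewrite -dE; apply: le_trans (expR_ge1Dx _); lra.
have s2n : n%:R <= s ^+ 2.
  by rewrite s2 ler_pdivlMr // ler_wpM2l // ltW.
have s0 : 0 <= s by exact: sqrtr_ge0.
(* Ensures [k - 1 >= s] for the integer [k] just above [(1 + e) * s]. *)
have es : 1 <= e * s.
  rewrite -(@ler_pXn2r _ 2) ?nnegrE //; last by rewrite mulr_ge0 // ltW.
  rewrite expr1n exprMn mulrC; apply: le_trans hn _.
  by rewrite ler_wpM2r // ltW.
set k := (Num.truncn ((1 + e) * s)).+1.
have t0 : 0 <= (1 + e) * s by rewrite mulr_ge0 //; lra.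
have kg : (1 + e) * s < k%:R by exact: truncnS_gt.
have kl : k%:R <= (1 + e) * s + 1 by rewrite -natr1 lerD2r truncn_le.
have s1 : 1 <= s by apply: le_trans es _; rewrite ler_piMl //; lra.
apply: le_trans (_ : gnp_prob p (fun G : graph n => `[< has_K_minor G k >]) <= _).
  have hp : 0 <= p <= 1 by lra.
  apply: gnp_prob_le => // G lt; apply/asboolP.
  apply: has_K_minor_le (has_K_minor_ccl G).
  by rewrite /k -(ltr_nat R); apply: le_lt_trans lt; rewrite truncn_le.
have k1 : (1 < k)%N by rewrite -(ltr_nat R); apply: le_lt_trans kg; lra.
have hp : 0 <= p <= 1 by lra.
have mu0 : 0 <= p * (1 + e / 4) by rewrite mulr_ge0; lra.
have hmu : expR (- (p * (1 + e / 4))) <= 1 - p.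
  rewrite expRN -[leRHS]invrK lef_pV2 ?posrE ?expR_gt0 ?invr_gt0; try lra.
  apply: le_trans (expR_ge1Dx _); rewrite -div1r ler_pdivrMr; last lra.
  have : 0 <= p * (e / 4 - p * (1 + e / 4)).
    apply: mulr_ge0; first lra.
    have : p * (1 + e / 4) <= e / 8 * 2 by apply: ler_pM; lra.
    by lra.
  by lra.
apply: le_trans (prob_K_minor_le n hp mu0 hmu k1) _.
set K : R := k%:R * (k%:R - 1).
have KX : (1 + e) * s ^+ 2 <= K.
  have h : (1 + e) * s * s <= k%:R * (k%:R - 1).
    by apply: ler_pM; rewrite // ?ltW //; lra.
  by rewrite expr2 mulrA.
have s20 : 0 < s ^+ 2 by apply: lt_le_trans s2n.
have K0 : 0 < K by apply: lt_le_trans KX; rewrite mulr_gt0 //; lra.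
have muA : p * (1 + e / 4) * (n%:R ^+ 2 / K) <= (1 - e / 4) * L.
  rewrite mulrA ler_pdivrMr //.
  apply: le_trans (_ : (1 - e / 4) * L * ((1 + e) * s ^+ 2) <= _); last first.
    by rewrite ler_wpM2l // mulr_ge0 ?(ltW L0) //; lra.
  have -> : (1 - e / 4) * L * ((1 + e) * s ^+ 2) =
     p * ((1 - e / 4) * (1 + e)) * n%:R ^+ 2 by rewrite s2; field; rewrite gt_eqF.
  rewrite ler_wpM2r ?exprn_ge0 // ler_wpM2l ?(ltW p0) //.
  have : 0 <= e * (2^-1 - e) by rewrite mulr_ge0; lra.
  by lra.
have lb : n%:R * (3 * L) <= 2^-1 * K * expR (- (p * (1 + e / 4) * (n%:R ^+ 2 / K))).
  apply: le_trans (_ : 2^-1 * s ^+ 2 * expR (- ((1 - e / 4) * L)) <= _); last first.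
    apply: ler_pM.
    - by apply: mulr_ge0; rewrite ?invr_ge0 // ltW.
    - exact: expR_ge0.
    - rewrite ler_wpM2l ?invr_ge0 //; apply: le_trans KX.
      by rewrite ler_peMl ?(ltW s20) //; lra.
    - by rewrite ler_expR lerN2.
  have -> : - ((1 - e / 4) * L) = e * L / 4 - L by ring.
  rewrite expRB dE s2.
  have -> : 2^-1 * (n%:R * (n%:R * p) / L) * (expR (e * L / 4) / (n%:R * p)) =
     n%:R * (expR (e * L / 4) / (2 * L)).
    by field; rewrite !gt_eqF.
  rewrite ler_wpM2l // ler_pdivlMr ?mulr_gt0 //.
  have x0 : 0 <= e * L / 4 by rewrite divr_ge0 ?mulr_ge0 ?ltW.
  (* The fourth-order term of the exponential contains [(L * e ^ 2) ^ 2], which is a large constant,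
     times [L ^ 2]; this beats [3 * L * (2 * L)]. *)
  apply: le_trans (_ : 1 + (e * L / 4) ^+ 4 / 24 <= _); last first.
    exact: (expR_ge1Dxn 3 x0).
  have -> : (e * L / 4) ^+ 4 / 24 = (L * e ^+ 2) * (L * e ^+ 2) * (L * L) / (24 * 2 ^+ 8) by field.
  have : 2 ^+ 8 * 2 ^+ 8 <= (L * e ^+ 2) * (L * e ^+ 2) by apply: ler_pM; rewrite ?exprn_ge0.
  move: ((L * e ^+ 2) * (L * e ^+ 2)) => Q hQ.
  have : 2 ^+ 8 * 2 ^+ 8 * (L * L) <= Q * (L * L).
    by rewrite ler_wpM2r // mulr_ge0 // ltW.
  have : 0 <= L * L by rewrite mulr_ge0 // ltW.
  by lra.
apply: le_trans (_ : expR (2 * L) ^+ n * expR (- (n%:R * (3 * L))) <= _).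
  apply: ler_pM; rewrite ?expR_ge0 ?ler_expR ?lerN2 //.
    by rewrite exprn_ge0 // addr_ge0 // mulr_ge0 // ltW.
  rewrite lerXn2r ?nnegrE ?expR_ge0 ?addr_ge0 ?mulr_ge0 ?ltW //.
  rewrite expRM_natl dE.
  have : 2 ^+ 8 <= n%:R * p by apply: le_trans L1 dL.
  move: (n%:R * p) => d d4.
  have : 0 <= (d - 4) * (d + 2) by rewrite mulr_ge0 //; lra.
  by lra.
rewrite -expRM_natl -expRD ler_expR.
have : n%:R * 1 <= n%:R * L by rewrite ler_wpM2l //; lra.
by lra.
Qed.

End UpperExplicit.

(** * Numerical budgets of the lower bound *)

Section LowerExplicit.
Variables (R : realType).
Implicit Types (p e : R).

Lemma pow_1B_le_expR p (m : nat) : 0 <= p <= 1 -> (1 - p) ^+ m <= expR (- (p * m%:R)).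
Proof.
move=> hp; rewrite -mulNr expRM_natr lerXn2r ?nnegrE ?expR_ge0 //; first lra.
exact: expR_ge1Dx.
Qed.

Lemma path_failure_le (n m : nat) p : 0 <= p <= 1 -> 3 * n%:R <= p * (m * m)%:R ->
  4 ^+ n * (1 - p) ^+ (m * m) <= expR (- n%:R).
Proof.
move=> hp h; apply: le_trans (_ : expR (2 * n%:R) * expR (- (p * (m * m)%:R)) <= _).
  apply: ler_pM; rewrite ?exprn_ge0 //; first lra.
    rewrite expRM_natr lerXn2r ?nnegrE ?expR_ge0 //.
    have -> : expR 2 = expR 1 ^+ 2 :> R by rewrite -expRM_natl mulr1.
    have -> : 4 = 2 ^+ 2 :> R by ring.
    rewrite lerXn2r ?nnegrE ?expR_ge0 //.
    by apply: le_trans (expR_ge1Dx _); lra.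
  exact: pow_1B_le_expR.
by rewrite -expRD ler_expR; lra.
Qed.

Lemma expRN_le_inv (x : R) : 0 < x -> expR (- x) <= x^-1.
Proof.
move=> x0; rewrite expRN lef_pV2 ?posrE ?expR_gt0 //.
by apply: le_trans (expR_ge1Dx _); lra.
Qed.

(** [tau] is the size of each of [s] equal parts of [N] vertices. The relative gap [e] between [k]
    and [s] pays for cores longer by a factor up to [1 + e / 8], for the rounding, and for
    [e * N / 2] spare vertices. *)
Lemma branch_params (N s tau e : R) :
  0 < e <= 2^-1 -> 0 <= s -> 0 <= tau -> s * tau = N -> 4 <= e * s -> 16 <= e * tau ->
  exists k b : nat, [/\ (1 - e) * s < k%:R, (k.-1)%:R <= (1 - e) * s, k%:R <= s,
    (1 + e / 16) * tau <= b%:R & k%:R * b%:R <= (1 - e / 2) * N].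
Proof.
move=> /andP[e0 e1] s0 tau0 stN es etau.
have t0 : 0 <= (1 - e) * s by rewrite mulr_ge0 //; lra.
have t1 : 0 <= (1 + e / 8) * tau by rewrite mulr_ge0 //; lra.
have hk := truncn_itv t0; have hb := truncn_itv t1.
exists (Num.truncn ((1 - e) * s)).+1, (Num.truncn ((1 + e / 8) * tau)).
move: (Num.truncn _) hk => k /andP[k1 k2].
move: (Num.truncn _) hb => b /andP[b1]; rewrite -[b.+1%:R]natr1 => b2.
rewrite -[k.+1%:R]natr1 in k2 *.
have kl : k%:R + 1 <= (1 - 3 * e / 4) * s by lra.
split=> //=; try lra.
apply: le_trans (_ : ((1 - 3 * e / 4) * s) * ((1 + e / 8) * tau) <= _).
  by apply: ler_pM; rewrite ?addr_ge0.
have -> : ((1 - 3 * e / 4) * s) * ((1 + e / 8) * tau) =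
   (1 - 3 * e / 4) * (1 + e / 8) * N by rewrite -stN; ring.
rewrite ler_wpM2r -?stN ?mulr_ge0 //.
have : 0 <= e * e by rewrite mulr_ge0 // ltW.
by lra.
Qed.

Lemma stage_budget (N p e L tau x0 B : R) :
  0 < e -> 0 < p -> 0 < L -> 0 < N -> 0 < tau -> tau ^+ 2 = L / p -> tau <= B ->
  0 < x0 -> x0 ^+ 2 * (e * N) <= 2 ^+ 12 -> 2 ^+ 26 <= e ^+ 3 * (N * p) * L ->
  2 * x0 / B <= e / 64 * p.
Proof.
move=> e0 p0 L0 N0 tau0 tau2 tauB x00 x0N big.
have B0 : 0 < B by apply: lt_le_trans tauB.
have ep0 : 0 <= e / 128 * p by apply: mulr_ge0; rewrite ?divr_ge0 // ltW.
rewrite ler_pdivrMr //.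
suff : x0 <= e / 128 * p * B by lra.
apply: le_trans (_ : e / 128 * p * tau <= _); last by rewrite ler_wpM2l.
have t0 : 0 <= e / 128 * p * tau by rewrite mulr_ge0 // ltW.
rewrite -(@ler_pXn2r _ 2) ?nnegrE ?(ltW x00) // exprMn tau2.
have -> : (e / 128 * p) ^+ 2 * (L / p) = e ^+ 2 * p * L / 2 ^+ 14.
  by field; rewrite gt_eqF.
have eN : 0 < e * N by rewrite mulr_gt0.
rewrite -(ler_pM2r eN); apply: le_trans x0N _.
have -> : e ^+ 2 * p * L / 2 ^+ 14 * (e * N) = e ^+ 3 * (N * p) * L / 2 ^+ 14 by ring.
by lra.
Qed.

Lemma path_budget (N p e M : R) : 0 < e -> 0 < p -> 0 < N ->
  e * N / 32 <= M -> 2 ^+ 18 <= e ^+ 3 * (N * p) -> 3 * N <= e / 64 * p * (M * M).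
Proof.
move=> e0 p0 N0 hM big.
have x0 : 0 <= e * N / 32 by rewrite divr_ge0 ?mulr_ge0 // ltW.
have MM : e * N / 32 * (e * N / 32) <= M * M by apply: ler_pM.
apply: le_trans (_ : e / 64 * p * (e * N / 32 * (e * N / 32)) <= _); last first.
  by rewrite ler_wpM2l // mulr_ge0 ?divr_ge0 // ltW.
have -> : e / 64 * p * (e * N / 32 * (e * N / 32)) = N * (e ^+ 3 * (N * p) / 2 ^+ 16).
  by field.
by rewrite [3 * N]mulrC ler_wpM2l ?(ltW N0) //; lra.
Qed.

(** Since [tau ^+ 2 * p = L], cores of size [tau] would be nonadjacent with probability about
    [expR (- L)]. Their excess length gains [e / 16] twice, the probability reserved for other
    rounds loses [e / 32], and a net gain of [e / 16] remains. *)
Lemma nonadjacent_le (b : nat) (p e L tau : R) :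
  0 < e <= 2^-1 -> 0 < p <= 1 -> 0 < L -> 0 < tau -> tau ^+ 2 = L / p ->
  (1 + e / 16) * tau <= b%:R ->
  (1 - (1 - e / 32) * p) ^+ (b * b) <= expR (- L) * expR (- (e * L / 16)).
Proof.
move=> /andP[e0 e1] /andP[p0 p1] L0 tau0 tau2 tb.
have q1 : 0 <= (1 - e / 32) * p <= 1.
  rewrite mulr_ge0 ?(ltW p0) //=; last by lra.
  by apply: mulr_ile1; lra.
apply: le_trans (pow_1B_le_expR _ q1) _.
rewrite -expRD ler_expR -opprD lerN2 natrM.
have t0 : 0 <= (1 + e / 16) * tau by rewrite mulr_ge0 ?(ltW tau0) //; lra.
apply: le_trans (_ : (1 - e / 32) * p * (((1 + e / 16) * tau) * ((1 + e / 16) * tau)) <= _);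
  last first.
  rewrite ler_wpM2l //; first by case/andP: q1.
  by apply: ler_pM.
have -> : (1 - e / 32) * p * ((1 + e / 16) * tau * ((1 + e / 16) * tau)) =
   (1 - e / 32) * (1 + e / 16) ^+ 2 * (tau ^+ 2 * p) by ring.
rewrite tau2 divfK ?gt_eqF //.
have -> : L + e * L / 16 = (1 + e / 16) * L by ring.
rewrite ler_wpM2r ?(ltW L0) //.
have : 0 <= e * (2^-1 - e) by apply: mulr_ge0; lra.
have : 0 <= e ^+ 2 * (2^-1 - e) by apply: mulr_ge0; rewrite ?exprn_ge0; lra.
have : 0 <= e ^+ 2 by rewrite exprn_ge0 // ltW.
by lra.
Qed.

(** At most [N * d] pairs, each missing with probability at most [exp(- e * L / 16) / d], leave
    about [16 * N / (e * L)]. By [L * e ^+ 2 >= 2 ^+ 21], three times this is at most half of the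
    initial allowance [M / 2 ^+ 9]. *)
Lemma pairs_budget (N d e L k s q M : R) : 0 < e <= 2^-1 -> 1 <= L -> 0 < N -> 0 <= k ->
  k <= s -> d = expR L -> s ^+ 2 = N * d / L -> 0 <= q ->
  q <= expR (- L) * expR (- (e * L / 16)) -> e * N / 32 <= M ->
  2 ^+ 21 <= L * e ^+ 2 -> 3 * q * (k * k) <= M / 2 ^+ 10.
Proof.
move=> /andP[e0 e1] L1 N0 k0 ks dE s2 q0 qle hM hL.
have L0 : 0 < L by lra.
have kk : k * k <= N * d.
  apply: le_trans (_ : s ^+ 2 <= _); first by rewrite expr2; apply: ler_pM.
  rewrite s2 ler_pdivrMr // ler_peMr // mulr_ge0 ?(ltW N0) // dE.
  exact: expR_ge0.
have eL : 0 < e * L / 16 by rewrite divr_gt0 // mulr_gt0.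
have qk : q * (k * k) <= N * (e * L / 16)^-1.
  apply: le_trans (_ : expR (- L) * expR (- (e * L / 16)) * (N * d) <= _).
    by apply: ler_pM; rewrite // mulr_ge0.
  have -> : expR (- L) * expR (- (e * L / 16)) * (N * d) = N * expR (- (e * L / 16)).
    by rewrite dE expRN; field; rewrite gt_eqF ?expR_gt0.
  by rewrite ler_wpM2l ?(ltW N0) // expRN_le_inv.
have : N * (e * L / 16)^-1 <= N * (e / (3 * 2 ^+ 15)).
  have c0 : 0 < e / (3 * 2 ^+ 15) by rewrite divr_gt0 // mulr_gt0 // exprn_gt0.
  rewrite ler_wpM2l ?(ltW N0) // -[leRHS]invrK lef_pV2 ?posrE ?invr_gt0 //.
  rewrite invf_div ler_pdivrMr //.
  have -> : e * L / 16 * e = L * e ^+ 2 / 16 by ring.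
  by lra.
by lra.
Qed.

(** The target is half of the initial degree allowance [1 / (8 * x0)]. After squaring,
    [k * k <= N * d] and [q <= 1 / d] leave a multiple of [N * x0 ^+ 2 / d], and [x0 ^+ 2] is of
    order [1 / (e * N)]. *)
Lemma degree_budget (N d e L k s q x0 : R) : 0 < e -> 1 <= L -> 0 < N -> 0 <= k ->
  k <= s -> d = expR L -> s ^+ 2 = N * d / L -> 0 <= q -> q <= expR (- L) ->
  0 < x0 -> x0 ^+ 2 * (e * N) <= 2 ^+ 12 -> 2 ^+ 26 <= e * d ->
  3 * q * (2 * k) <= 1 / (16 * x0).
Proof.
move=> e0 L1 N0 k0 ks dE s2 q0 qle x00 x0N big.
have L0 : 0 < L by lra.
have d0 : 0 < d by rewrite dE expR_gt0.
have kk : k * k <= N * d.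
  apply: le_trans (_ : s ^+ 2 <= _); first by rewrite expr2; apply: ler_pM.
  by rewrite s2 ler_pdivrMr // ler_peMr // mulr_ge0 // ltW.
rewrite ler_pdivlMr ?mulr_gt0 //.
suff : 96 * (q * k * x0) <= 1 by lra.
have t0 : 0 <= 96 * (q * k * x0) by rewrite !mulr_ge0 // ltW.
rewrite -(@ler_pXn2r _ 2) ?nnegrE // expr1n.
have -> : (96 * (q * k * x0)) ^+ 2 = 9 * 2 ^+ 10 * ((q * q) * (k * k) * x0 ^+ 2) by ring.
have h1 : (q * q) * (k * k) <= (expR (- L) * expR (- L)) * (N * d).
  apply: ler_pM; rewrite ?mulr_ge0 //.
  by apply: ler_pM.
have e1 : (expR (- L) * expR (- L)) * (N * d) = N / d.
  by rewrite expRN -dE; field; rewrite gt_eqF.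
rewrite e1 in h1.
have h2 : (q * q) * (k * k) * x0 ^+ 2 <= N / d * x0 ^+ 2.
  by rewrite ler_wpM2r // exprn_ge0 // ltW.
suff : N / d * x0 ^+ 2 <= 2^-1 ^+ 14 by lra.
rewrite mulrAC ler_pdivrMr //.
rewrite -(ler_pM2l e0).
have -> : e * (N * x0 ^+ 2) = x0 ^+ 2 * (e * N) by ring.
apply: le_trans x0N _.
have -> : e * (2^-1 ^+ 14 * d) = (e * d) * 2^-1 ^+ 14 by ring.
by lra.
Qed.

End LowerExplicit.

(** * Lower tail of [ccl] *)

Section LowerAssembly.
Variables (R : realType).
Implicit Types (p e : R).

Lemma scale_facts (N p e L s : R) : 0 < e <= 2^-1 -> 0 < p -> 0 < N -> L = ln (N * p) ->
  2 ^+ 21 <= L * e ^+ 2 -> s = Num.sqrt (N ^+ 2 * p / L) ->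
  [/\ 2 ^+ 21 <= L, expR L = N * p, s ^+ 2 = N * (N * p) / L, 0 < s & N <= s ^+ 2] /\
  [/\ 2 ^+ 41 <= e ^+ 3 * (N * p), 2 ^+ 41 <= e * (N * p) &
      (N / s) ^+ 2 = L / p].
Proof.
move=> /andP[e0 e1] p0 N0 LE hL sE.
have e20 : 0 < e ^+ 2 by rewrite exprn_gt0.
have e1' : 0 <= e <= 1 by lra.
have [e0' e1''] := andP e1'.
have e21 : e ^+ 2 <= 1 by rewrite exprn_ile1.
have L0 : 0 < L by rewrite -(pmulr_lgt0 _ e20); apply: lt_le_trans hL; rewrite exprn_gt0.
have L1 : 2 ^+ 21 <= L by apply: le_trans hL _; rewrite ler_piMr // ltW.
have d0 : 0 < N * p by rewrite mulr_gt0.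
have dE : expR L = N * p by rewrite LE lnK.
have s2 : s ^+ 2 = N * (N * p) / L.
  by rewrite sE sqr_sqrtr ?divr_ge0 ?mulr_ge0 ?(ltW L0) ?(ltW p0) ?exprn_ge0 ?(ltW N0) // expr2 mulrA.
have dL : L <= N * p by rewrite -dE; apply: le_trans (expR_ge1Dx _); rewrite lerDr.
have s20 : 0 < s ^+ 2 by rewrite s2 divr_gt0 // mulr_gt0.
have s2n : N <= s ^+ 2 by rewrite s2 ler_pdivlMr // ler_wpM2l // ltW.
have sge0 : 0 <= s by rewrite sE; exact: sqrtr_ge0.
have s0 : 0 < s by rewrite lt_def sge0 andbT; apply: contraTneq s20 => ->; rewrite expr0n ltxx.
have dL2 : L ^+ 2 / 2 <= N * p.
  by rewrite -dE; apply: le_trans (expR_ge1Dxn 1 (ltW L0)); rewrite lerDr.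
have big : 2 ^+ 41 <= e ^+ 4 * (N * p).
  apply: le_trans (_ : e ^+ 4 * (L ^+ 2 / 2) <= _); last by rewrite ler_wpM2l // exprn_ge0.
  have -> : e ^+ 4 * (L ^+ 2 / 2) = (L * e ^+ 2) * (L * e ^+ 2) / 2 by ring.
  rewrite ler_pdivlMr // -exprSr (_ : 42 = 21 + 21)%N // exprD.
  by apply: ler_pM; rewrite ?exprn_ge0.
split; split=> //.
- apply: le_trans big _; rewrite ler_wpM2r ?(ltW d0) //.
  by rewrite ler_wiXn2l.
- apply: le_trans big _; rewrite ler_wpM2r ?(ltW d0) //.
  by rewrite -[leRHS]expr1 ler_wiXn2l.
by rewrite exprMn exprVn s2; field; rewrite !gt_eqF.
Qed.

(** The edge probability is split into [e / 64 * p] for the path, [(1 - e / 32) * p] for joining the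
    segments, and a last [e / 64 * p] for all connector rounds together. *)
Lemma prob_ccl_lt (n T : nat) p e
    (s := Num.sqrt (n%:R ^+ 2 * p / ln (n%:R * p))) (U := 2 ^+ T : R) :
  0 < e <= 2^-1 -> 0 < p -> p <= e ^+ 2 / 2 ^+ 8 -> 2 ^+ 21 <= ln (n%:R * p) * e ^+ 2 ->
  U ^+ 8 <= n%:R -> 2 ^+ 12 <= e * U ^+ 4 ->
  gnp_prob p (fun G : graph n => (ccl G)%:R < (1 - e) * s) <=
  expR (- n%:R) + T.+1%:R * ((1 + n%:R) * expR (- (e * U ^+ 2 / 2 ^+ 13)))
  + n%:R * expR (- (8 * U)).
Proof.
move=> he p0 pe hL hU hn; have /andP[e0 e1] := he.
have U1 : 1 <= U by rewrite exprn_ege1 // ler1n.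
have U0 : 0 < U := lt_le_trans ltr01 U1.
have N0 : 0 < n%:R :> R by apply: lt_le_trans hU; rewrite exprn_gt0.
have [[L1 dE s2 s0 s2n] [e3d ed tau2]] := scale_facts he p0 N0 erefl hL erefl.
rewrite -/s in s2 s0 s2n tau2 *; set L := ln _ in hL L1 dE s2 tau2 *.
have L1' : 1 <= L by apply: le_trans L1; rewrite exprn_ege1 // ler1n.
have L0 : 0 < L := lt_le_trans ltr01 L1'.
have e20 : 0 < e ^+ 2 by rewrite exprn_gt0.
have e2e : e ^+ 2 <= e by rewrite expr2 ler_piMr //; clear -e0 e1; lra.
have p1 : p <= 1 by clear -pe e2e e1; lra.
have hp : 0 < p <= 1 by rewrite p0.
have eUn : 2 ^+ 24 <= e ^+ 2 * n%:R.
  apply: le_trans (_ : (e * U ^+ 4) * (e * U ^+ 4) <= _).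
    rewrite (_ : 24 = 12 + 12)%N // exprD.
    by apply: ler_pM; rewrite ?exprn_ge0.
  have -> : (e * U ^+ 4) * (e * U ^+ 4) = e ^+ 2 * U ^+ 8 by ring.
  by rewrite ler_wpM2l // ltW.
have eN : 0 < e * n%:R by rewrite mulr_gt0.
have en24 : 2 ^+ 24 <= e * n%:R.
  by apply: le_trans eUn _; rewrite ler_wpM2r // ltW.
have es : 4 <= e * s.
  rewrite -(@ler_pXn2r _ 2) ?nnegrE //; last by rewrite mulr_ge0 // ltW.
  rewrite exprMn; apply: le_trans (_ : e ^+ 2 * n%:R <= _).
    by clear -eUn; lra.
  by rewrite ler_wpM2l // ltW.
set tau := n%:R / s in tau2.
have tau0 : 0 < tau by rewrite divr_gt0.
have etau : 16 <= e * tau.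
  rewrite -(@ler_pXn2r _ 2) ?nnegrE //; last by rewrite mulr_ge0 // ltW.
  rewrite exprMn tau2 mulrA ler_pdivlMr //.
  by clear -pe hL e2e e1; lra.
have stN : s * tau = n%:R by rewrite /tau mulrC divfK // gt_eqF.
have [k [b [kg kg' ks bg kb]]] := branch_params he (ltW s0) (ltW tau0) stN es etau.
have btau : tau <= b%:R.
  by apply: le_trans bg; rewrite ler_peMl ?(ltW tau0) //; clear -e0; lra.
have bR0 : 0 < b%:R :> R by exact: lt_le_trans btau.
have en0 : 0 <= e * n%:R / 16 by rewrite divr_ge0 // ltW.
have /andP[ml] := truncn_itv en0.
(* The same [m], about [e * n / 16], is the scale [M] of the connectors and the set size in the path
   lemma: [3 * m + 2 * m] fits into the [e * n / 2] spare vertices. *)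
set m := Num.truncn _ in ml *; rewrite -[m.+1%:R]natr1 => mg'.
have mg : e * n%:R / 32 <= m%:R by clear -mg' en24; lra.
have mR0 : 0 < m%:R :> R by apply: lt_le_trans mg; rewrite divr_gt0.
have mn : m%:R <= n%:R :> R.
  have : e * n%:R <= 1 * n%:R by rewrite ler_wpM2r ?(ltW N0) //; clear -e1; lra.
  by clear -ml N0; lra.
pose x0 : R := Num.sqrt (128 / m%:R).
have x02 : x0 ^+ 2 = 128 / m%:R by rewrite sqr_sqrtr ?divr_ge0 // ltW.
have x00 : 0 < x0 by rewrite sqrtr_gt0 divr_gt0.
have x0n : x0 ^+ 2 * (e * n%:R) <= 2 ^+ 12.
  by rewrite x02 mulrAC ler_pdivrMr //; clear -mg; lra.
have x0U : x0 * (e * U ^+ 4) <= 64.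
  rewrite -(@ler_pXn2r _ 2) ?nnegrE //; last first.
    by rewrite mulr_ge0 ?mulr_ge0 ?exprn_ge0 // ltW.
  have -> : (x0 * (e * U ^+ 4)) ^+ 2 = x0 ^+ 2 * (e ^+ 2 * U ^+ 8) by ring.
  apply: le_trans (_ : x0 ^+ 2 * (e * n%:R) <= _).
    rewrite ler_wpM2l ?exprn_ge0 ?(ltW x00) //.
    by apply: ler_pM; rewrite // exprn_ge0 // ltW.
  by clear -x0n; lra.
have p10 : 0 <= e / 64 * p by rewrite mulr_ge0 ?divr_ge0 // ltW.
have p11 : e / 64 * p <= 1.
  by rewrite mulr_ile1 ?divr_ge0 ?(ltW e0) ?(ltW p0) //; clear -e1; lra.
have p20 : 0 <= (1 - e / 32) * p by rewrite mulr_ge0 ?(ltW p0) //; clear -e1; lra.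
have xb : 2 * x0 / b%:R <= e / 64 * p.
  apply: (stage_budget e0 p0 L0 N0 tau0 tau2 btau x00 x0n).
  apply: le_trans (_ : 2 ^+ 41 * 1 <= _); first by rewrite mulr1 ler_weXn2l // ler1n.
  by apply: ler_pM; rewrite ?exprn_ge0.
have pp : e / 64 * p + (1 - e / 32) * p + 2 * x0 / b%:R <= p.
  by clear -xb; lra.
have budget : (k * b + 3 * m + 2 * m <= n)%N.
  rewrite -(ler_nat R) !natrD !natrM; move: kb ml (mulr_ge0 (ltW e0) (ltW N0)).
  move: (k%:R * b%:R) (m%:R) => kb' m' h1 h2 h3; clear -h1 h2 h3; lra.
have MT : (128 * 16 ^ T <= m)%N.
  rewrite -(ler_nat R) natrM natrX.
  have -> : 16 ^+ T = U ^+ 4 :> R by rewrite /U -exprM mulnC exprM; congr (_ ^+ _); ring.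
  apply: le_trans mg; have : 2 ^+ 12 * U ^+ 4 <= e * U ^+ 4 * U ^+ 4.
    by rewrite ler_wpM2r // exprn_ge0 // ltW.
  have : e * U ^+ 4 * U ^+ 4 <= e * n%:R.
    by rewrite -mulrA -exprD ler_wpM2l // ltW.
  by clear; lra.
have b0 : (0 < b)%N by rewrite -(ltr_nat R).
have m0 : (0 < m)%N by rewrite -(ltr_nat R).
have kn : k%:R <= n%:R :> R.
  rewrite ler_nat; apply: leq_trans budget; rewrite -addnA.
  by apply: leq_trans (leq_addr _ _); rewrite leq_pmulr.
have hmin := prob_minor_ge b0 m0 (erefl x0) MT p10 p20 pp p1 budget.
apply: le_trans (_ : 1 - gnp_prob p (fun G : graph n => `[< has_K_minor G k >]) <= _).
  rewrite -gnp_probC; apply: gnp_prob_le; first by rewrite (ltW p0).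
  move=> G lt; apply/negP => /asboolP/leq_ccl kc.
  have : k%:R <= (ccl G)%:R :> R by rewrite ler_nat.
  by move=> /(lt_le_trans kg)/lt_trans/(_ lt); rewrite ltxx.
apply: le_trans (_ : base_failure n k b m (e / 64 * p) ((1 - e / 32) * p) x0 +
   T%:R * stage_failure k T x0 + pairs_left x0 T * expR (- (8 * (2 ^ T)%:R)) <= _).
  by move: hmin; clear; lra.
set E := expR (- (e * U ^+ 2 / 2 ^+ 13)).
have E0 : 0 <= E by exact: expR_ge0.
have rT : rate x0 T = U ^+ 2 * x0.
  by rewrite /rate /U -exprM mulnC exprM; congr (_ ^+ _ * _); ring.
have U2 : U ^+ 2 <= U ^+ 4 by rewrite ler_weXn2l.
have eU0 : 0 <= e * U ^+ 2 by rewrite mulr_ge0 ?exprn_ge0 // ltW.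
have toE (z : R) : e * U ^+ 2 / 2 ^+ 13 <= - z -> expR z <= E.
  by move=> h; rewrite ler_expR lerNr.
have Estage : expR (- (1 / (128 * rate x0 T))) <= E.
  apply: toE; rewrite opprK rT ler_pdivlMr ?mulr_gt0 ?exprn_gt0 //.
  have -> : e * U ^+ 2 / 2 ^+ 13 * (128 * (U ^+ 2 * x0)) = x0 * (e * U ^+ 4) / 64 by field.
  by clear -x0U; lra.
have kE (z : R) : z <= E -> k%:R * z <= n%:R * E.
  move=> zE; apply: le_trans (_ : k%:R * E <= _); first by rewrite ler_wpM2l.
  by rewrite ler_wpM2r.
have q0 : 0 <= (1 - (1 - e / 32) * p) ^+ (b * b).
  rewrite exprn_ge0 // subr_ge0 mulr_ile1 ?(ltW p0) //; clear -e0 e1; lra.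
have qle := nonadjacent_le he hp L0 tau0 tau2 bg.
have qle' : (1 - (1 - e / 32) * p) ^+ (b * b) <= expR (- L).
  apply: le_trans qle _; rewrite ler_piMr ?expR_ge0 // expR_le1 oppr_le0.
  by rewrite divr_ge0 ?mulr_ge0 // ltW.
have k0 : 0 <= k%:R :> R by [].
have pb := pairs_budget he L1' N0 k0 ks (esym dE) s2 q0 qle mg hL.
have ed26 : 2 ^+ 26 <= e * (n%:R * p) by apply: le_trans ed; rewrite ler_weXn2l // ler1n.
have db := degree_budget e0 L1' N0 k0 ks (esym dE) s2 q0 qle' x00 x0n ed26.
have r0 : pairs_left x0 0 = m%:R / 2 ^+ 9.
  by rewrite /pairs_left /rate expr0 [1 * x0]mul1r x02; field; rewrite gt_eqF.
have D0 : degree_left x0 0 = 2 * (1 / (16 * x0)).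
  by rewrite /degree_left /rate expr0 [1 * x0]mul1r; field; rewrite gt_eqF.
have base : base_failure n k b m (e / 64 * p) ((1 - e / 32) * p) x0 <=
   expR (- n%:R) + (1 + n%:R) * E.
  rewrite /base_failure; apply: lerD.
    apply: path_failure_le; first by rewrite p10.
    rewrite natrM; apply: path_budget => //.
    by apply: le_trans e3d; rewrite ler_weXn2l // ler1n.
  rewrite [leRHS]mulrDl [X in _ <= X + _]mul1r; apply: lerD.
    apply: toE; rewrite r0 natrM.
    have U4 : 4 <= U ^+ 4.
      have : e * U ^+ 4 <= 1 * U ^+ 4.
        by rewrite ler_wpM2r ?exprn_ge0 ?(ltW U0) //; clear -e1; lra.
      by move: hn; clear; lra.
    have : e * U ^+ 2 * 4 <= e * n%:R.
      rewrite -mulrA ler_wpM2l ?(ltW e0) //; apply: le_trans hU.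
      apply: le_trans (_ : U ^+ 2 * U ^+ 4 <= _).
        by rewrite ler_wpM2l // exprn_ge0 // ltW.
      by rewrite -exprD ler_weXn2l.
    by move: pb mg eU0; clear; lra.
  apply: kE; apply: toE; rewrite D0 natrM.
  have : e * U ^+ 2 / 2 ^+ 13 <= 1 / (16 * x0).
    rewrite ler_pdivlMr ?mulr_gt0 //.
    have : x0 * (e * U ^+ 2) <= x0 * (e * U ^+ 4).
      by rewrite ler_wpM2l ?(ltW x00) // ler_wpM2l // ltW.
    by move: x0U; clear; lra.
  by move: db; clear; lra.
have stage : T%:R * stage_failure k T x0 <= T%:R * ((1 + n%:R) * E).
  rewrite ler_wpM2l // /stage_failure; apply: ler_pM; rewrite ?expR_ge0 ?addr_ge0 //.
  by rewrite lerD2l.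
have final : pairs_left x0 T * expR (- (8 * (2 ^ T)%:R)) <= n%:R * expR (- (8 * U)).
  rewrite natrX; apply: ler_wpM2r; first exact: expR_ge0.
  rewrite /pairs_left rT exprMn x02 -exprM.
  apply: le_trans mn; rewrite ler_pdivrMr ?mulr_gt0 ?invr_gt0 ?exprn_gt0 //.
  have -> : m%:R * (4 * (U ^+ (2 * 2) * (128 / m%:R))) = 512 * U ^+ 4.
    by field; rewrite gt_eqF.
  have : 1 <= U ^+ 4 by rewrite exprn_ege1.
  by clear; lra.
move: base stage final; rewrite -[T.+1%:R]natr1; clear; lra.
Qed.

End LowerAssembly.

(** * Combination of the two tails *)

Section Concentration.
Variables (R : realType).
Implicit Types (p e : R).

Lemma expRN_le_pow (x : R) m : 0 < x -> expR (- x) <= (m.+1)`!%:R / x ^+ m.+1.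
Proof.
move=> x0; have xm : 0 < x ^+ m.+1 by rewrite exprn_gt0.
have f0 : 0 < (m.+1)`!%:R :> R by rewrite ltr0n fact_gt0.
rewrite expRN -[leRHS]invrK lef_pV2 ?posrE ?expR_gt0 ?invr_gt0 ?divr_gt0 //.
by rewrite invf_div; apply: le_trans (expR_ge1Dxn m (ltW x0)); rewrite lerDr.
Qed.

(** The exponentials are replaced by inverse powers that leave [1 / U]: [(U ^ 2) ^ 5] against
    [U * U ^ 8], and [U ^ 9] against [U ^ 8], as [T + 1 <= U] and [n] is of order [U ^ 8]. The 2
    covers the two terms [exp(- n)]. *)
Definition decay_const e : R :=
  2 + 2 ^+ 10 * (5`!%:R * (2 ^+ 13 / e) ^+ 5) + 2 ^+ 8 * 9`!%:R.

Lemma failure_le (n T : nat) e (U := 2 ^+ T : R) : 0 < e ->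
  U ^+ 8 <= n%:R -> n%:R <= 2 ^+ 8 * U ^+ 8 ->
  expR (- n%:R) + (expR (- n%:R) + T.+1%:R * ((1 + n%:R) * expR (- (e * U ^+ 2 / 2 ^+ 13)))
  + n%:R * expR (- (8 * U))) <= decay_const e / U.
Proof.
move=> e0 hU hn.
have U1 : 1 <= U by rewrite exprn_ege1 // ler1n.
have U0 : 0 < U := lt_le_trans ltr01 U1.
have U8 : U <= U ^+ 8 by rewrite -[leLHS]expr1 ler_weXn2l.
have N0 : 0 < n%:R :> R by apply: lt_le_trans hU; rewrite exprn_gt0.
have h1 : expR (- n%:R) <= U^-1.
  apply: le_trans (expRN_le_inv N0) _; rewrite lef_pV2 ?posrE //.
  exact: le_trans U8 hU.
have h3 : n%:R * expR (- (8 * U)) <= 2 ^+ 8 * 9`!%:R / U.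
  have UU : expR (- (8 * U)) <= 9`!%:R / U ^+ 9.
    apply: le_trans (expRN_le_pow 8 U0); rewrite ler_expR lerN2 ler_peMl ?(ltW U0) //.
    by rewrite ler1n.
  apply: le_trans (_ : 2 ^+ 8 * U ^+ 8 * (9`!%:R / U ^+ 9) <= _).
    by apply: ler_pM; rewrite ?expR_ge0.
  move: (9`!%:R : R) => F; rewrite le_eqVlt; apply/orP; left; apply/eqP.
  by field; rewrite gt_eqF.
have h2 : T.+1%:R * ((1 + n%:R) * expR (- (e * U ^+ 2 / 2 ^+ 13))) <=
    2 ^+ 10 * (5`!%:R * (2 ^+ 13 / e) ^+ 5) / U.
  have x0 : 0 < e * U ^+ 2 / 2 ^+ 13 by rewrite divr_gt0 ?mulr_gt0 ?exprn_gt0.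
  have TU : T.+1%:R <= U.
    by rewrite /U -natrX ler_nat ltn_expl.
  have n1 : 1 + n%:R <= 2 ^+ 10 * U ^+ 8.
    have : 1 <= U ^+ 8 by exact: le_trans U1 U8.
    by move: hn; clear; lra.
  apply: le_trans (_ : U * (2 ^+ 10 * U ^+ 8 * (5`!%:R / (e * U ^+ 2 / 2 ^+ 13) ^+ 5)) <= _).
    apply: ler_pM; rewrite ?mulr_ge0 ?addr_ge0 ?expR_ge0 //.
    apply: ler_pM; rewrite ?addr_ge0 ?expR_ge0 //.
    exact: (expRN_le_pow 4).
  move: (5`!%:R : R) => F; rewrite le_eqVlt; apply/orP; left; apply/eqP.
  by field; rewrite !gt_eqF.
move: h1 h2 h3; rewrite /decay_const.
move: (2 ^+ 10 * _) (2 ^+ 8 * 9`!%:R) => a b h1 h2 h3.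
have -> : (2 + a + b) / U = U^-1 + U^-1 + a / U + b / U by ring.
by rewrite !addrA !lerD.
Qed.

Lemma gnp_prob_le1 (n : nat) p (P : pred (graph n)) : 0 <= p <= 1 -> gnp_prob p P <= 1.
Proof.
move=> hp; rewrite -(Ex_cst n p 1) gnp_probE; apply: ler_Ex => // G.
by case: (P G).
Qed.

(** Rounding the logarithm down to a multiple of 8 costs a factor of at most [2 ^ 8]. *)
Lemma trunc_log_bounds8 (n : nat) (U := (2 ^ (trunc_log 2 n %/ 8))%N) : (0 < n)%N ->
  (U ^ 8 <= n < 256 * U ^ 8)%N.
Proof.
move=> n0; have := trunc_log_bounds (isT : (1 < 2)%N) n0.
move: (trunc_log 2 n) @U => t U /andP[lo hi]; apply/andP; split.
  by apply: leq_trans lo; rewrite /U -expnM leq_exp2l // leq_divM.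
apply: leq_trans hi _; rewrite (_ : 256 = 2 ^ 8)%N // /U -expnM -expnD leq_exp2l //.
by have := ltn_ceil t (isT : (0 < 8)%N); rewrite mulSn.
Qed.

(** The size of [n] forces [2 ^ T > M]. The first summand in [M] then gives [e ^+ 2 * U >= 2 ^+ 12],
    the second makes the total failure probability at most [eta]. *)
Lemma prob_ccl_ge (n : nat) p e eta
    (s := Num.sqrt (n%:R ^+ 2 * p / ln (n%:R * p)))
    (M := (Num.truncn (2 ^+ 12 / e ^+ 2 + decay_const e / eta)).+1) :
  0 < e <= 2^-1 -> 0 < p -> p <= e ^+ 2 / 2 ^+ 8 ->
  2 ^+ 21 <= ln (n%:R * p) * e ^+ 2 -> 0 < eta -> (256 * M ^ 8 <= n)%N ->
  1 - eta <= gnp_prob p (fun G : graph n =>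
    ((1 - e) * s <= (ccl G)%:R) && ((ccl G)%:R <= (1 + e) * s)).
Proof.
move=> he p0 pe hL eta0 Mn; have /andP[e0 e1] := he.
have e20 : 0 < e ^+ 2 by rewrite exprn_gt0.
have e2e : e ^+ 2 <= e by rewrite expr2 ler_piMr //; clear -e0 e1; lra.
have p1 : p <= 1 by move: pe e2e e1; clear; lra.
have hp : 0 <= p <= 1 by rewrite (ltW p0).
have dc0 : 0 <= decay_const e.
  have c0 : 0 <= 2 ^+ 13 / e by rewrite divr_ge0 ?exprn_ge0 // ltW.
  rewrite /decay_const; apply: addr_ge0.
    apply: addr_ge0 => //; apply: mulr_ge0; first exact: exprn_ge0.
    by apply: mulr_ge0; [exact: ler0n|exact: exprn_ge0].
  by apply: mulr_ge0; [exact: exprn_ge0|exact: ler0n].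
have n0 : (0 < n)%N.
  by apply: leq_trans Mn; rewrite muln_gt0 expn_gt0.
set T := (trunc_log 2 n %/ 8)%N.
have /andP[lo hi] := trunc_log_bounds8 n0; rewrite -/T in lo hi.
have MU : (M < 2 ^ T)%N.
  have := leq_ltn_trans Mn hi; rewrite ltn_pmul2l // ltn_exp2r //.
pose U : R := 2 ^+ T.
have UE : (2 ^ T)%:R = U by rewrite natrX.
have loR : U ^+ 8 <= n%:R by rewrite -UE -natrX ler_nat.
have hiR : n%:R <= 2 ^+ 8 * U ^+ 8.
  have -> : 2 ^+ 8 = 256%:R :> R by rewrite -natrX.
  by rewrite -UE -natrX -natrM ler_nat ltnW.
have U1 : 1 <= U by rewrite exprn_ege1 // ler1n.
have U0 : 0 < U := lt_le_trans ltr01 U1.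
have MUR : 2 ^+ 12 / e ^+ 2 + decay_const e / eta <= U.
  apply: ltW; apply: lt_le_trans (truncnS_gt _) _; rewrite -/M -UE ler_nat ltnW //.
have U12 : 2 ^+ 12 <= e ^+ 2 * U.
  rewrite mulrC -ler_pdivrMr //; apply: le_trans MUR; rewrite lerDl.
  by rewrite divr_ge0 // ltW.
have Ueta : decay_const e / U <= eta.
  rewrite ler_pdivrMr // mulrC -ler_pdivrMr //; apply: le_trans MUR; rewrite lerDr.
  by rewrite divr_ge0 ?exprn_ge0 // ltW.
have eU4 : 2 ^+ 12 <= e * U ^+ 4.
  apply: le_trans U12 _; apply: ler_pM; rewrite ?(ltW e20) ?(ltW U0) //.
  by rewrite -[leLHS]expr1 ler_weXn2l.
have ne : 1 <= n%:R * e ^+ 2.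
  rewrite mulrC; apply: le_trans (_ : e ^+ 2 * U <= _).
    by apply: le_trans U12; rewrite exprn_ege1 // ler1n.
  rewrite ler_wpM2l ?(ltW e20) //; apply: le_trans loR.
  by rewrite -[leLHS]expr1 ler_weXn2l.
have hL8 : 2 ^+ 8 <= ln (n%:R * p) * e ^+ 2.
  by apply: le_trans hL; rewrite ler_weXn2l // ler1n.
have p8 : p <= e / 8 by move: pe e2e e0; clear; lra.
have up := prob_ccl_gt he p0 p8 hL8 ne.
have low := prob_ccl_lt he p0 pe hL loR eU4.
rewrite -/s in up low.
rewrite lerBlDr -lerBlDl -gnp_probC.
apply: le_trans Ueta; apply: le_trans (failure_le e0 loR hiR).
apply: le_trans (lerD up low); apply: le_trans (gnp_probU _ _ hp).
by apply: gnp_prob_le => // G; rewrite negb_and -!ltNge orbC.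
Qed.

End Concentration.

(* Imported late: the notations of classical sets shadow those of finite sets. *)
From mathcomp Require Import all_classical all_reals all_analysis.
Import numFieldNormedType.Exports.
Local Open Scope classical_set_scope.
Local Open Scope ring_scope.

Theorem theorem1 (R : realType) (eps : R) (heps : 0 < eps) :
  exists C : R,
    forall p : nat -> R,
      (forall n, 0 <= p n <= 1) ->
      (exists N : nat, forall n : nat, (N <= n)%N -> C <= n%:R * p n) ->
      p @ \oo --> (0 : R) ->
      (fun n : nat =>
         gnp_prob (p n)
           (fun G : graph n =>
              ((1 - eps) * Num.sqrt (n%:R ^+ 2 * p n / ln (n%:R * p n))
                 <= (ccl G)%:R) &&
              ((ccl G)%:R
                 <= (1 + eps) * Num.sqrt (n%:R ^+ 2 * p n / ln (n%:R * p n)))))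
        @ \oo --> (1 : R).
Proof.
(* A smaller [e] gives a stronger conclusion, and the estimates assume [e <= 1/2]. *)
pose e := Num.min eps 2^-1.
have e0 : 0 < e by rewrite lt_min heps invr_gt0 ltr0n.
have e1 : e <= 2^-1 by rewrite ge_min lexx orbT.
have eeps : e <= eps by rewrite ge_min lexx.
have e20 : 0 < e ^+ 2 by rewrite exprn_gt0.
(* Chosen so that [C <= n * p] becomes [2 ^+ 21 <= ln (n * p) * e ^+ 2]. *)
exists (expR (2 ^+ 21 / e ^+ 2)) => p hp [N1 hN1] p_to0.
apply/cvgrPdist_le => eta eta0.
have c0 : 0 < e ^+ 2 / 2 ^+ 8 by rewrite divr_gt0 // exprn_gt0.
have [N2 _ hN2] := (cvgrPdist_le _ _).1 p_to0 _ c0.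
pose M := (Num.truncn (2 ^+ 12 / e ^+ 2 + decay_const e / eta)).+1.
exists (maxn (maxn N1 N2) (256 * M ^ 8)) => // n /=.
rewrite !geq_max => /andP[/andP[n1 n2] n3].
have hC := hN1 n n1.
have hsmall : p n <= e ^+ 2 / 2 ^+ 8.
  by have := hN2 n n2; rewrite sub0r normrN ger0_norm //; case/andP: (hp n).
have d0 : 0 < n%:R * p n by apply: lt_le_trans hC; exact: expR_gt0.
have p0 : 0 < p n.
  rewrite lt_def (andP (hp n)).1 andbT; apply: contraTneq d0 => ->.
  by rewrite mulr0 ltxx.
have hL : 2 ^+ 21 <= ln (n%:R * p n) * e ^+ 2.
  by rewrite -ler_pdivrMr // -[leLHS]expRK ler_ln ?posrE ?expR_gt0.
have he : 0 < e <= 2^-1 by rewrite e0.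
have := prob_ccl_ge he p0 hsmall hL eta0 n3.
set s := Num.sqrt _ => low.
have s0 : 0 <= s by exact: sqrtr_ge0.
set f := gnp_prob _ _.
have f1 : f <= 1 by exact: gnp_prob_le1.
have lf : 1 - eta <= f.
  apply: le_trans low _; apply: gnp_prob_le => // G /andP[h1 h2]; apply/andP; split.
    by apply: le_trans h1; rewrite ler_wpM2r // lerD2l lerN2.
  by apply: le_trans h2 _; rewrite ler_wpM2r // lerD2l.
by rewrite ger0_norm ?subr_ge0 // lerBlDr -lerBlDl.
Qed.
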